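(* Let $m$ and $n$ be non-negative integers and let $z\in\mathbb{C}$ with $\Re(z)>0$. Then $$\mathcal{F}(2n,2m+1;z)=\frac{\pi e^{-z}}{2^{2n}z}\,P(z),\qquad \mathcal{F}(2n+1,2m;z)=\frac{\pi e^{-z}}{2^{2n+1}z}\,\hat P(z),$$ where $P(z)$ and $\hat P(z)$ are the polynomials in $z^{-1}$ given by $$P(z)=\begin{cases}\displaystyle\sum_{p=0}^{2m}C_p(m,n)\,z^{-p} & (m\ge n),\\[2mm] \displaystyle\sum_{p=0}^{2n-1}D_p(m,n)\,z^{-p} & (m<n),\end{cases}\qquad \hat P(z)=\begin{cases}\displaystyle\sum_{p=0}^{2m-1}\hat C_p(m,n)\,z^{-p} & (m>n),\\[2mm] \displaystyle\sum_{p=0}^{2n}\hat D_p(m,n)\,z^{-p} & (m\le n),\end{cases}$$ with the coefficients $C_p(m,n)$, $D_p(m,n)$, $\hat C_p(m,n)$, $\hat D_p(m,n)$ defined explicitly as in the context.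
   Context: For $\mu\ge 0$, $\nu\in\mathbb{C}$ and $\Re(z)>0$, $$\mathcal{F}(\mu,\nu;z):=\int_0^\infty \cosh^\mu t\;K_\nu(z\cosh t)\,dt,$$ where $K_\nu$ is the modified Bessel function of the second kind (principal branch). Notation: $\sum_{k=0}^{n}{}'$ means that the term $k=n$ is multiplied by the factor $\tfrac12$. For an integer $N\ge 0$ and an integer $r\ge 0$ put $$\beta_r(N)=\frac{(N+r)!}{r!\,(N-r)!}\ \text{ if } 0\le r\le N,\qquad \beta_r(N)=0\ \text{ if } r>N$$ (i.e. $1/j!$ is read as $0$ for negative integers $j$). All sums over $r+s=p$ below are over integers $r,s\ge 0$. Coefficients for even $\mu=2n$, $\nu=2m+1$: (i) For $m\ge n$ and $0\le p\le 2m$, $$C_p(m,n)=\sum_{k=0}^{n}{}'\binom{2n}{k}c_p(k),\qquad c_p(k)=\sum_{r+s=p}\beta_r(m+n-k)\,\beta_s(m-n+k).$$ (ii) For $m<n$ and $0\le p\le 2n-1$, $$D_p(m,n)=\sum_{k=0}^{n}{}'\binom{2n}{k}d_p(k),\qquad d_p(k)=\sum_{r+s=p}\beta_r(m+n-k)\,\hat b_s,$$ where $\hat b_s=\beta_s(n-m-k-1)$ if $k\le n-m-1$, and $\hat b_s=\beta_s(m-n+k)$ if $k\ge n-m$. Coefficients for odd $\mu=2n+1$, $\nu=2m$ (here the sums over $k$ are ordinary, unprimed sums): (iii) For $m>n$ and $0\le p\le 2m-1$, $$\hat C_p(m,n)=\sum_{k=0}^{n}\binom{2n+1}{k}\hat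 c_p(k),\qquad \hat c_p(k)=\sum_{r+s=p}\beta_r(m+n-k)\,\beta_s(m-n+k-1).$$ (iv) For $m\le n$ and $0\le p\le 2n$, $$\hat D_p(m,n)=\sum_{k=0}^{n}\binom{2n+1}{k}\hat d_p(k),\qquad \hat d_p(k)=\sum_{r+s=p}\beta_r(m+n-k)\,\tilde b_s,$$ where $\tilde b_s=\beta_s(n-m-k)$ if $k\le n-m$, and $\tilde b_s=\beta_s(m-n+k-1)$ if $k\ge n-m+1$. *)

(* Defs.v *)
From mathcomp Require Import all_boot all_order all_algebra.
From mathcomp Require Import complex.
From mathcomp Require Import all_classical all_reals all_analysis.

Set Implicit Arguments.
Unset Strict Implicit.
Unset Printing Implicit Defensive.

Import Order.TTheory GRing.Theory Num.Theory.
Import numFieldNormedType.Exports.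

Local Open Scope classical_set_scope.
Local Open Scope ring_scope.
Local Open Scope complex_scope.

Section BesselIntegral.
Variable R : realType.
Local Notation C := R[i].

Definition cexp (z : C) : C :=
  (expR (complex.Re z) * cos (complex.Im z))
    +i* (expR (complex.Re z) * sin (complex.Im z)).

Definition ccosh (z : C) : C := (cexp z + cexp (- z)) / 2%:R.

Definition rcosh (t : R) : R := (expR t + expR (- t)) / 2%:R.

(* Lebesgue integral over [0, +oo) of a complex-valued function of a real
   variable, taken componentwise. *)
Definition cintegral0y (f : R -> C) : C :=
  (\int[lebesgue_measure]_(t in `[0%R, +oo[) complex.Re (f t))
    +i* (\int[lebesgue_measure]_(t in `[0%R, +oo[) complex.Im (f t)).

(* Modified Bessel function of the second kind (Macdonald function), of
   complex order nu, defined on the half-plane Re z > 0 by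
     K_nu(z) = int_0^oo exp(- z cosh u) cosh(nu u) du.
   On that half-plane it is the principal branch of K_nu; the value of this
   definition is meaningful only there. *)
Definition besselK (nu z : C) : C :=
  cintegral0y (fun u => cexp (- (z * (rcosh u)%:C)) * ccosh (nu * u%:C)).

Definition calF (mu : R) (nu z : C) : C :=
  cintegral0y (fun t => (rcosh t `^ mu)%:C * besselK nu (z * (rcosh t)%:C)).

End BesselIntegral.

(* The natural-number subtractions below are never truncated for the indices
   that occur with nonzero weight in [sumP] and [sumPhat],
   since each coefficient is used only in its own range of (m, n).  The
   integer m - n + k is written m + k - n. *)
Section Coefficients.
Variable F : numFieldType.
Implicit Types m n p k r s N : nat.

Definition betaCoef N r : F :=
  if (r <= N)%N then ((N + r)`!)%:R / ((r`!)%:R * ((N - r)`!)%:R) else 0.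

Definition convCoef (a b : nat -> F) p : F := \sum_(r < p.+1) a r * b (p - r)%N.

(* The sum over 0 <= k <= n whose last term, k = n, is halved. *)
Definition psum n (f : nat -> F) : F := \sum_(k < n) f k + f n / 2%:R.

Definition coefC m n p : F :=
  psum n (fun k => 'C(2 * n, k)%:R *
    convCoef (betaCoef (m + n - k)) (betaCoef (m + k - n)) p).

Definition bhat m n k : nat -> F :=
  if (k <= n - m - 1)%N then betaCoef (n - m - k - 1) else betaCoef (m + k - n).

Definition coefD m n p : F :=
  psum n (fun k => 'C(2 * n, k)%:R * convCoef (betaCoef (m + n - k)) (bhat m n k) p).

Definition coefChat m n p : F :=
  \sum_(k < n.+1) 'C((2 * n).+1, k)%:R *
    convCoef (betaCoef (m + n - k)) (betaCoef (m + k - n - 1)) p.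

Definition btilde m n k : nat -> F :=
  if (k <= n - m)%N then betaCoef (n - m - k) else betaCoef (m + k - n - 1).

Definition coefDhat m n p : F :=
  \sum_(k < n.+1) 'C((2 * n).+1, k)%:R *
    convCoef (betaCoef (m + n - k)) (btilde m n k) p.

Definition sumP m n (z : F) : F :=
  if (n <= m)%N then \sum_(p < (2 * m).+1) coefC m n p * z ^- p
  else \sum_(p < 2 * n) coefD m n p * z ^- p.

Definition sumPhat m n (z : F) : F :=
  if (n < m)%N then \sum_(p < 2 * m) coefChat m n p * z ^- p
  else \sum_(p < (2 * n).+1) coefDhat m n p * z ^- p.

End Coefficients.

(* Main.v *)
From HB Require Import structures.
Require Import Defs.
From mathcomp Require Import all_boot all_order all_algebra.
From mathcomp Require Import complex.
From mathcomp Require Import all_classical all_reals all_analysis.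
From mathcomp Require Import measurable_realfun.
From mathcomp Require Import ring lra zify.
Import Order.TTheory GRing.Theory Num.Theory.
Import numFieldNormedType.Exports.

(** The integral over t and u of cosh^M t cosh(N u) e^{-z cosh t cosh u} is a
    double integral over a quadrant, which evenness extends to the whole plane
    and where cosh and its powers can be replaced with exponentials.  In the
    variables x = t + u and y = t - u,
<<
      2 cosh t cosh u = cosh x + cosh y,
>>
    so that the integral of e^{jt + Nu} e^{-z cosh t cosh u} over the plane
    becomes a product of two integrals over the line: it is twice the product
    of the Macdonald functions of orders (j + N)/2 and (j - N)/2 at z/2
    ([cint_planar]).  Expanding cosh^M t by the binomial theorem, with
    j = M - 2k, then expresses the integral of the theorem as a binomial sum of
    such products ([calF_sum]).

    Since M and N have opposite parities, all the orders are half-integers.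
    The Macdonald function is even in its order and satisfies the recurrence
    K_{a+1} = K_{a-1} + (2a/w) K_a ([macdonald_recurrence]), which is also the
    recurrence of the Bessel polynomials, with the coefficients beta
    ([betaCoef_rec]); hence K_{N+1/2}(z/2) is K_{1/2}(z/2) times such a
    polynomial in 1/z ([macdonald_halfinteger]).  Each product therefore has the
    factor K_{1/2}(z/2)^2 = pi e^{-z} / z, which comes from the square of a
    Gaussian integral with a complex parameter ([gauss_square]), and the
    coefficients of the product of two polynomials are the convolutions c_p,
    d_p and their variants.

    Finally, k and M - k contribute equally to the sum ([calF_term_sym]), so it
    is twice the sum over k <= n; for M = 2n the middle term k = n counts only
    half, and this is the primed sum. *)
Set Implicit Arguments.
Unset Strict Implicit.
Unset Printing Implicit Defensive.
Local Open Scope classical_set_scope.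
Local Open Scope ring_scope.
Local Open Scope complex_scope.

Local Notation normc := ComplexField.Normc.normc.
Local Notation normcM := ComplexField.Normc.normcM.

(** * The complex exponential and the modulus *)

Section cexp_theory.
Variable R : realType.
Implicit Types (x y : R) (z w : R[i]).

Lemma complex_ext z w :
  complex.Re z = complex.Re w -> complex.Im z = complex.Im w -> z = w.
Proof. by case: z => a b; case: w => c d /= -> ->. Qed.

Lemma Re_add z w : complex.Re (z + w) = complex.Re z + complex.Re w.
Proof. by case: z; case: w. Qed.
Lemma Im_add z w : complex.Im (z + w) = complex.Im z + complex.Im w.
Proof. by case: z; case: w. Qed.
Lemma Re_mul z w : complex.Re (z * w) =
  complex.Re z * complex.Re w - complex.Im z * complex.Im w.
Proof. by case: z; case: w. Qed.
Lemma Im_mul z w : complex.Im (z * w) =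
  complex.Re z * complex.Im w + complex.Im z * complex.Re w.
Proof. by case: z; case: w. Qed.
Lemma Re_opp z : complex.Re (- z) = - complex.Re z. Proof. by case: z. Qed.
Lemma Im_opp z : complex.Im (- z) = - complex.Im z. Proof. by case: z. Qed.

Definition Re_ImE := (Re_add, Im_add, Re_mul, Im_mul, Re_opp, Im_opp).

Lemma cexpD z w : cexp (z + w) = cexp z * cexp w.
Proof.
by apply: complex_ext; rewrite !Re_ImE /= !(Re_add, Im_add) expRD ?cosD ?sinD; ring.
Qed.

Lemma cexpR x : cexp x%:C = (expR x)%:C.
Proof. by rewrite /cexp /= cos0 sin0 mulr1 mulr0. Qed.

Lemma normc_ge0 z : 0 <= normc z.
Proof. by case: z => a b /=; exact: sqrtr_ge0. Qed.

Lemma normcR x : normc x%:C = `|x|.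
Proof. by rewrite /= expr0n/= addr0 sqrtr_sqr. Qed.

Lemma normc_cexp z : normc (cexp z) = expR (complex.Re z).
Proof.
rewrite /cexp /= !exprMn -mulrDr cos2Dsin2 mulr1 sqrtr_sqr.
by rewrite ger0_norm// expR_ge0.
Qed.

Lemma normc_Re z : `|complex.Re z| <= normc z.
Proof.
by case: z => a b /=; rewrite -sqrtr_sqr ler_wsqrtr// lerDl sqr_ge0.
Qed.

Lemma normc_Im z : `|complex.Im z| <= normc z.
Proof.
by case: z => a b /=; rewrite -sqrtr_sqr ler_wsqrtr// lerDr sqr_ge0.
Qed.

Lemma normc_le z : normc z <= `|complex.Re z| + `|complex.Im z|.
Proof.
case: z => a b /=; rewrite -[leRHS]ger0_norm ?addr_ge0// -sqrtr_sqr.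
apply: ler_wsqrtr; rewrite sqrrD !real_normK ?num_real// lerD2r lerDl.
by rewrite mulrn_wge0// mulr_ge0.
Qed.

Lemma rcosh_gt0 x : 0 < rcosh x.
Proof. by rewrite /rcosh divr_gt0// addr_gt0// expR_gt0. Qed.

Lemma rcoshN x : rcosh (- x) = rcosh x.
Proof. by rewrite /rcosh opprK addrC. Qed.

Lemma ccoshR x : ccosh x%:C = (rcosh x)%:C.
Proof.
rewrite /ccosh /rcosh -rmorphN !cexpR -rmorphD/= rmorphM/= fmorphV.
by rewrite rmorph_nat.
Qed.

End cexp_theory.

(** * Integration of complex-valued functions *)

Section cintegral.
Local Notation Re := complex.Re.
Local Notation Im := complex.Im.
Context d (T : measurableType d) (R : realType).
Implicit Types (f g : T -> R[i]).

(** Everything is componentwise, because the Bessel function and the integral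
    of the theorem are defined through real and imaginary parts. *)
Definition cmeas f :=
  measurable_fun setT (fun x => Re (f x)) /\ measurable_fun setT (fun x => Im (f x)).

Lemma cmeas_cst (c : R[i]) : cmeas (fun=> c).
Proof. by split; exact: measurable_cst. Qed.

Lemma cmeas_real (r : T -> R) : measurable_fun setT r -> cmeas (fun x => (r x)%:C).
Proof. by move=> mr; split => //=; exact: measurable_cst. Qed.

Lemma cmeasM f g : cmeas f -> cmeas g -> cmeas (fun x => f x * g x).
Proof.
move=> [f1 f2] [g1 g2]; split.
  under eq_fun do rewrite Re_mul.
  by apply: measurable_funB; exact: measurable_funM.
under eq_fun do rewrite Im_mul.
by apply: measurable_funD; exact: measurable_funM.
Qed.

Lemma cmeasN f : cmeas f -> cmeas (fun x => - f x).
Proof.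
move=> [f1 f2]; split.
  by under eq_fun do rewrite Re_opp; exact: measurable_funN.
by under eq_fun do rewrite Im_opp; exact: measurable_funN.
Qed.

Lemma cmeas_cexp f : cmeas f -> cmeas (fun x => cexp (f x)).
Proof.
move=> [f1 f2]; split => /=; apply: measurable_funM;
  apply: measurableT_comp => //.
- by apply: continuous_measurable_fun; exact: continuous_cos.
- by apply: continuous_measurable_fun; exact: continuous_sin.
Qed.

Lemma cmeas_normc f : cmeas f -> measurable_fun setT (fun x => normc (f x)).
Proof.
move=> [f1 f2].
rewrite (_ : (fun _ => _) = (fun x => Num.sqrt (Re (f x) ^+ 2 + Im (f x) ^+ 2))).
  apply: measurableT_comp.
    by apply: continuous_measurable_fun; exact: sqrt_continuous.
  by apply: measurable_funD; exact: measurable_funX.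
by apply/funext => x; case: (f x).
Qed.

Variable mu : {measure set T -> \bar R}.

Definition cintegrable f :=
  mu.-integrable setT (fun x => (Re (f x))%:E) /\
  mu.-integrable setT (fun x => (Im (f x))%:E).

Definition cint f : R[i] :=
  (\int[mu]_x Re (f x)) +i* (\int[mu]_x Im (f x)).

Lemma cintegrable_dom f (g : T -> R) : cmeas f ->
  (forall x, normc (f x) <= g x) -> mu.-integrable setT (EFin \o g) ->
  cintegrable f.
Proof.
move=> [mf1 mf2] fg ig; split; apply: le_integrable ig => //.
- exact/measurable_EFinP.
- move=> x _ /=; rewrite lee_fin (le_trans (normc_Re _))// (le_trans (fg x))//.
  exact: ler_norm.
- exact/measurable_EFinP.
- move=> x _ /=; rewrite lee_fin (le_trans (normc_Im _))// (le_trans (fg x))//.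
  exact: ler_norm.
Qed.

Lemma cintegrable_cmeas f : cintegrable f -> cmeas f.
Proof.
by move=> [/measurable_int/measurable_EFinP ? /measurable_int/measurable_EFinP ?].
Qed.

Lemma cintegrableD f g : cintegrable f -> cintegrable g ->
  cintegrable (fun x => f x + g x).
Proof.
move=> [f1 f2] [g1 g2]; split.
  by under eq_fun do rewrite Re_add EFinD; exact: integrableD.
by under eq_fun do rewrite Im_add EFinD; exact: integrableD.
Qed.

Lemma cintegrableZ (c : R[i]) f : cintegrable f -> cintegrable (fun x => c * f x).
Proof.
move=> [f1 f2]; split.
  under eq_fun do rewrite Re_mul EFinB !EFinM.
  by apply: integrableB => //; exact: integrableZl.
under eq_fun do rewrite Im_mul EFinD !EFinM.
by apply: integrableD => //; exact: integrableZl.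
Qed.

Lemma eq_cint f g : f =1 g -> cint f = cint g.
Proof. by move=> fg; congr cint; exact/funext. Qed.

Lemma cintD f g : cintegrable f -> cintegrable g ->
  cint (fun x => f x + g x) = cint f + cint g.
Proof.
move=> [f1 f2] [g1 g2]; apply: complex_ext => /=.
  rewrite -RintegralD//; apply: eq_Rintegral => x _; exact: Re_add.
rewrite -RintegralD//; apply: eq_Rintegral => x _; exact: Im_add.
Qed.

Lemma cintZ (c : R[i]) f : cintegrable f -> cint (fun x => c * f x) = c * cint f.
Proof.
move=> [f1 f2]; apply: complex_ext.
  rewrite Re_mul -!RintegralZl// -RintegralB//.
  - by apply: eq_Rintegral => x _; rewrite Re_mul.
  - exact: (integrableZl _ _ f1).
  - exact: (integrableZl _ _ f2).
rewrite Im_mul -!RintegralZl// -RintegralD//.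
- by apply: eq_Rintegral => x _; rewrite Im_mul.
- exact: (integrableZl _ _ f2).
- exact: (integrableZl _ _ f1).
Qed.

Lemma cintegrable_sum n (F : nat -> T -> R[i]) :
  (forall k, cintegrable (F k)) -> cintegrable (fun x => \sum_(k < n) F k x).
Proof.
move=> iF; elim: n => [|n ih].
  under eq_fun do rewrite big_ord0; split; exact: integrable0.
by under eq_fun do rewrite big_ord_recr/=; exact: cintegrableD.
Qed.

Lemma cint_sum n (F : nat -> T -> R[i]) :
  (forall k, cintegrable (F k)) ->
  cint (fun x => \sum_(k < n) F k x) = \sum_(k < n) cint (F k).
Proof.
move=> iF; elim: n => [|n ih].
  rewrite big_ord0 (_ : (fun _ => _) = fun=> 0); last first.
    by apply/funext => x; rewrite big_ord0.
  by apply: complex_ext; rewrite /= /Rintegral integral0.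
rewrite big_ord_recr/= -ih -cintD//; last exact: cintegrable_sum.
by apply: eq_cint => x; rewrite big_ord_recr.
Qed.

Lemma cintegrable_normc f : cintegrable f ->
  mu.-integrable setT (fun x => (normc (f x))%:E).
Proof.
move=> icf; have [i1 i2] := icf.
have := integrableD measurableT (integrable_norm i1) (integrable_norm i2).
apply: le_integrable => //.
  by apply/measurable_EFinP; apply: cmeas_normc; exact: cintegrable_cmeas.
move=> x _ /=; rewrite lee_fin ger0_norm ?normc_ge0//.
by rewrite (le_trans (normc_le _))// ler_norm.
Qed.

End cintegral.

(** * Exchanging the order of integration *)

Section fubini.
Context d1 d2 (T1 : measurableType d1) (T2 : measurableType d2) (R : realType).
Variables (m1 : {sigma_finite_measure set T1 -> \bar R})
  (m2 : {sigma_finite_measure set T2 -> \bar R}).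

(** Bounding the inner integrals of |h| by an integrable g is enough: Tonelli
    makes h integrable on the product.  All sections, and not just almost all
    of them, are integrable, which makes the iterated real-valued integrals
    agree with the iterated extended-real ones. *)
Lemma Rfubini (h : T1 -> T2 -> R) (g : T1 -> R) :
  measurable_fun setT (fun p : T1 * T2 => h p.1 p.2) ->
  m1.-integrable setT (EFin \o g) ->
  (forall x, (\int[m2]_y `|(h x y)%:E| <= (g x)%:E)%E) ->
  (forall y, m1.-integrable setT (fun x => (h x y)%:E)) ->
  [/\ forall x, m2.-integrable setT (fun y => (h x y)%:E),
      m1.-integrable setT (fun x => (\int[m2]_y h x y)%:E) &
      \int[m1]_x \int[m2]_y h x y = \int[m2]_y \int[m1]_x h x y].
Proof.
move=> mh ig hg ih.
have mf : measurable_fun setT (fun p : T1 * T2 => (h p.1 p.2)%:E).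
  exact/measurable_EFinP.
have mhx x : measurable_fun setT (fun y => h x y).
  apply: (measurableT_comp mh (g := fun y => (x, y))); exact: pair1_measurable.
have ihx : forall x, m2.-integrable setT (fun y => (h x y)%:E).
  move=> x; apply/integrableP; split; first exact/measurable_EFinP.
  by rewrite (le_lt_trans (hg x))// ltry.
have imf : (m1 \x m2)%E.-integrable setT (fun p : T1 * T2 => (h p.1 p.2)%:E).
  apply/integrable12ltyP => //=.
  apply: (@le_lt_trans _ _ (\int[m1]_x0 `|(g x0)%:E|)%E); last first.
    by case/integrableP : ig.
  apply: ge0_le_integral => //.
  - by move=> x _; exact: integral_ge0.
  - apply: (measurable_fun_fubini_tonelli_F (fun p : T1 * T2 => `|(h p.1 p.2)%:E|%E)) => //.
    exact: measurableT_comp.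
  - by apply: measurableT_comp => //; exact: measurable_int ig.
  - move=> x _; rewrite (le_trans (hg x))//= lee_fin; exact: ler_norm.
have E1 x : ((\int[m2]_y0 h x y0)%:E = \int[m2]_y0 (h x y0)%:E)%E.
  by rewrite /Rintegral fineK//; exact: integrable_fin_num.
have E2 y : ((\int[m1]_x0 h x0 y)%:E = \int[m1]_x0 (h x0 y)%:E)%E.
  by rewrite /Rintegral fineK//; exact: integrable_fin_num.
split => //.
  under eq_fun do rewrite E1.
  exact: (integrable_fubini_F imf).
have := Fubini imf; rewrite /= => EF.
rewrite {1}/Rintegral [in RHS]/Rintegral.
under eq_integral do rewrite E1.
by under [in RHS]eq_integral do rewrite E2; rewrite EF.
Qed.

Lemma cfubini (f : T1 -> T2 -> R[i]) (g : T1 -> R) :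
  cmeas (fun p : T1 * T2 => f p.1 p.2) ->
  m1.-integrable setT (EFin \o g) ->
  (forall x, (\int[m2]_y (normc (f x y))%:E <= (g x)%:E)%E) ->
  (forall y, cintegrable m1 (f ^~ y)) ->
  [/\ forall x, cintegrable m2 (f x),
      cintegrable m1 (fun x => cint m2 (f x)) &
      cint m1 (fun x => cint m2 (f x)) = cint m2 (fun y => cint m1 (f ^~ y))].
Proof.
move=> mf ig fg ify; have [mf1 mf2] := mf.
have mN x : measurable_fun setT (fun y => normc (f x y)).
  apply: (measurableT_comp (cmeas_normc mf) (g := fun y => (x, y))); exact: pair1_measurable.
have [] := @Rfubini (fun x y => complex.Re (f x y)) g mf1 ig.
- move=> x; apply: le_trans (fg x); apply: ge0_le_integral => //.
  + apply: measurableT_comp => //; apply/measurable_EFinP.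
    apply: (measurableT_comp mf1 (g := fun y => (x, y))); exact: pair1_measurable.
  + exact/measurable_EFinP.
  + by move=> y _; rewrite lee_fin normc_Re.
- by move=> y; exact: (ify y).1.
move=> i1 i2 i3.
have [] := @Rfubini (fun x y => complex.Im (f x y)) g mf2 ig.
- move=> x; apply: le_trans (fg x); apply: ge0_le_integral => //.
  + apply: measurableT_comp => //; apply/measurable_EFinP.
    apply: (measurableT_comp mf2 (g := fun y => (x, y))); exact: pair1_measurable.
  + exact/measurable_EFinP.
  + by move=> y _; rewrite lee_fin normc_Im.
- by move=> y; exact: (ify y).2.
move=> j1 j2 j3.
by split => //; rewrite /cint/= i3 j3.
Qed.

End fubini.

(** * Affine substitutions *)

Section affine.
Variable R : realType.
Local Notation mu := (@lebesgue_measure R).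

Section measure_affine.
Variables (a b : R).
Hypothesis a0 : a != 0.
Let phi : measurableTypeR R -> measurableTypeR R := fun x : R => a * x + b.

Let mphi : measurable_fun setT phi.
Proof. by apply: measurable_funD => //; exact: measurable_funM. Qed.

Let scaled_pushforward : {measure set (measurableTypeR R) -> \bar R} :=
  mscale (NngNum (normr_ge0 a))
    (measure_function_pushforward__canonical__measure_function_Measure mu mphi).

(** Both sides give the same length to half-open intervals, and this
    determines Lebesgue measure. *)
Let lebesgue_measure_affine (A : set (measurableTypeR R)) : measurable A ->
  mu A = scaled_pushforward A.
Proof.
apply: lebesgue_measure_unique => X [[p q] _ <-] /=.
rewrite /mscale/= /pushforward/=.
have [a_gt0|a_le0] := ltP 0 a.
  rewrite (_ : phi @^-1` _ = `](p - b) / a, (q - b) / a]%classic); last first.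
    apply/seteqP; split => x /=; rewrite !in_itv/= /phi;
      by rewrite ltr_pdivrMr// ler_pdivlMr// ltrBlDr lerBrDr mulrC.
  rewrite !lebesgue_measure_itv/= !lte_fin ltr_pM2r ?invr_gt0// ltrD2r.
  case: ifPn => _; last by rewrite mule0.
  by rewrite -!EFinB -EFinM gtr0_norm//; congr EFin; field.
have a_lt0 : a < 0 by rewrite lt_neqAle a0.
rewrite (_ : phi @^-1` _ = `[(q - b) / a, (p - b) / a[%classic); last first.
  apply/seteqP; split => x /=; rewrite !in_itv/= /phi;
    by rewrite ltr_ndivlMr// ler_ndivrMr// ltrBlDr lerBrDr mulrC andbC.
rewrite !lebesgue_measure_itv/= !lte_fin ltr_nM2r ?invr_lt0// ltrD2r.
case: ifPn => _; last by rewrite mule0.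
by rewrite -!EFinB -EFinM ltr0_norm//; congr EFin; field.
Qed.

Lemma ge0_integral_affine (f : R -> \bar R) :
  measurable_fun setT f -> (forall x, 0 <= f x)%E ->
  (\int[mu]_x f x = `|a|%:E * \int[mu]_x f (a * x + b)%R)%E.
Proof.
move=> mf f0.
transitivity (\int[scaled_pushforward]_x f x)%E.
  apply: eq_measure_integral => A mA _; exact: lebesgue_measure_affine.
by rewrite ge0_integral_mscale// ge0_integral_pushforward// preimage_setT.
Qed.

End measure_affine.

Lemma integrable_affine (a b : R) (f : R -> R) : a != 0 ->
  mu.-integrable setT (EFin \o f) ->
  mu.-integrable setT (fun x => (f (a * x + b))%:E).
Proof.
move=> a0 /integrableP[mf]; rewrite (ge0_integral_affine b a0)//; last first.
  exact: measurableT_comp.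
move=> foo; apply/integrableP; split.
  apply: (measurableT_comp mf (g := fun x => a * x + b)) => //.
  by apply: measurable_funD => //; exact: measurable_funM.
move: foo; rewrite /= !ltey; apply: contra => /eqP ->.
by rewrite mulry gtr0_sg ?normr_gt0// mul1e.
Qed.

Lemma Rintegral_affine (a b : R) (f : R -> R) : a != 0 ->
  mu.-integrable setT (EFin \o f) ->
  \int[mu]_x f x = `|a| * \int[mu]_x f (a * x + b).
Proof.
move=> a0 intf; have mf := measurable_int _ intf.
rewrite /Rintegral -[`|a|]/(fine `|a|%:E) -fineM//; last first.
  by apply: integrable_fin_num => //; exact: integrable_affine.
congr fine; rewrite [LHS]integralE [X in (_ * X)%E]integralE.
rewrite (ge0_integral_affine b a0 (measurable_funepos mf))//.
rewrite (ge0_integral_affine b a0 (measurable_funeneg mf))//.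
have H : mu.-integrable setT (fun x => (f (a * x + b))%:E).
  exact: integrable_affine.
rewrite [RHS]muleBr//.
  congr (_ * _ - _ * _)%E; apply: eq_integral => x _.
    by rewrite (funepos_comp (EFin \o f) (fun x => a * x + b)).
  by rewrite (funeneg_comp (EFin \o f) (fun x => a * x + b)).
apply: fin_num_adde_defl.
by rewrite fin_numN; exact: (integrable_neg_fin_num _ H).
Qed.

Lemma cintegrable_affine (a b : R) (f : R -> R[i]) : a != 0 ->
  cintegrable mu f -> cintegrable mu (fun x => f (a * x + b)).
Proof.
by move=> a0 [f1 f2]; split;
  [exact: (integrable_affine b a0 f1)|exact: (integrable_affine b a0 f2)].
Qed.

Lemma cint_affine (a b : R) (f : R -> R[i]) : a != 0 ->
  cintegrable mu f -> cint mu f = `|a|%:C * cint mu (fun x => f (a * x + b)).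
Proof.
move=> a0 [f1 f2]; apply: complex_ext.
  by rewrite /= (Rintegral_affine b a0 f1) mul0r subr0.
by rewrite /= (Rintegral_affine b a0 f2) mul0r addr0.
Qed.

End affine.

(** * Integrals over the half-line *)

Section half_line.
Variable R : realType.
Local Notation mu := (@lebesgue_measure R).

(** The negative half-line is reflected onto the positive one; this will turn
    every e^{ax} into a cosh(ax). *)
Lemma Rintegral_fold (f : R -> R) : mu.-integrable setT (EFin \o f) ->
  \int[mu]_x f x = \int[mu]_(x in `[0%R, +oo[) (f x + f (- x)).
Proof.
move=> intf.
have intfN : mu.-integrable setT (fun x => (f (- x))%:E).
  have := @integrable_affine R (-1) 0 f (ltac:(by rewrite oppr_eq0 oner_eq0)) intf.
  by apply: eq_integrable => // x _; rewrite /= mulN1r addr0.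
have iS (A : set (measurableTypeR R)) g : measurable A -> mu.-integrable setT g ->
  mu.-integrable A g by move=> mA; apply: integrableS.
rewrite RintegralD//; [|exact: iS|exact: iS].
rewrite -{1}(setUv `[0%R, +oo[%classic) Rintegral_setU//; last 3 first.
- exact: measurableC.
- by rewrite setUv.
- exact/disj_setPCl.
congr (_ + _); rewrite setCitvr/=.
rewrite Rintegral_mkcond.
have m0 : measurable (`]-oo, 0%R[%classic : set (measurableTypeR R)) by [].
have intf0 : mu.-integrable setT (EFin \o (f \_ `]-oo, 0%R[)).
  rewrite -restrict_EFin.
  by apply: (integrable_mkcond _ m0).1; exact: iS.
rewrite (@Rintegral_affine _ (-1) 0 _ _ intf0) ?oppr_eq0 ?oner_eq0//.
rewrite normrN1 mul1r -Rintegral_itv_obnd_cbnd; last exact: iS.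
rewrite [RHS]Rintegral_mkcond; apply: eq_Rintegral => x _.
rewrite mulN1r addr0 !patchE.
have -> // : (- x \in `]-oo, 0%R[%classic) = (x \in `]0%R, +oo[%classic).
by apply/idP/idP; rewrite !inE/= !in_itv/= ?andbT oppr_lt0.
Qed.

Lemma cint_fold (f : R -> R[i]) : cintegrable mu f ->
  cint mu f = cintegral0y (fun x => f x + f (- x)).
Proof.
move=> [f1 f2]; apply: complex_ext => /=.
  by rewrite (Rintegral_fold f1); apply: eq_Rintegral => x _; rewrite Re_add.
by rewrite (Rintegral_fold f2); apply: eq_Rintegral => x _; rewrite Im_add.
Qed.

(** Carries theorems about compact intervals over to the half-line. *)
Lemma Rintegral_itv_cvg (f : R -> R) (b : R^nat) :
  mu.-integrable `[0%R, +oo[ (EFin \o f) -> b @ \oo --> +oo ->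
  \int[mu]_(x in `[0%R, b n]) f x @[n --> \oo] -->
  \int[mu]_(x in `[0%R, +oo[) f x.
Proof.
move=> intf boo.
have mf : measurable_fun (`[0%R, +oo[%classic : set (measurableTypeR R)) f.
  by apply/measurable_EFinP; exact: measurable_int intf.
have mitv n : measurable (`[0%R, b n]%classic : set (measurableTypeR R)) by [].
have sub n : `[0%R, b n] `<=` `[0%R, +oo[.
  by move=> x /=; rewrite !in_itv/= andbT => /andP[].
have [|||||_ _ cv] := @dominated_convergence _ _ R mu
    (`[0%R, +oo[%classic : set (measurableTypeR R)) (measurable_itv _)
    (fun n => EFin \o (f \_ `[0%R, b n])) (EFin \o f) (EFin \o (fun x => `|f x|)).
- move=> n; apply/measurable_EFinP.
  apply/measurable_restrict => //.
  by apply: measurable_funS mf => // x [].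
- exact/measurable_EFinP.
- apply/aeW => x /=; rewrite in_itv/= andbT => x0.
  apply: cvg_EFin; first by near=> n.
  apply: cvg_near_cst; near=> n.
  rewrite /= patchE ifT//= inE/= in_itv/= x0/=.
  by near: n; exact: (cvgryPge b).1.
- exact: integrable_norm.
- apply/aeW => x n _; rewrite /= patchE; case: ifPn => _; rewrite lee_fin//.
  by rewrite normr0.
have fin : (\int[mu]_(x in `[0%R, +oo[) (f x)%:E)%E \is a fin_num.
  exact: integrable_fin_num.
move: cv; rewrite /= -(fineK fin) => /fine_cvg cv.
apply: cvg_trans cv.
apply: near_eq_cvg; near=> n => /=; rewrite /Rintegral; congr fine.
rewrite [RHS]integral_mkcond [LHS]integral_mkcond/=.
apply: eq_integral => x _; rewrite !patchE/=.
case: ifPn => x0; case: ifPn => xb //.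
by case/negP: x0; apply/mem_set/(sub n)/set_mem.
Unshelve. all: by end_near. Qed.

Lemma cvgy_natrS : (n.+1%:R : R) @[n --> \oo] --> +oo.
Proof.
apply/cvgryPge => A; near=> n; apply: (@le_trans _ _ n%:R).
  by near: n; exact: nbhs_infty_ger.
by rewrite ler_nat.
Unshelve. all: by end_near. Qed.

(** The integrands of interest oscillate, so that the limit of the integrals
    over [0, n] comes from dominated instead of monotone convergence; whence
    the integrability hypothesis. *)
Lemma Rintegral_FTC2y (f F : R -> R) (l : R) :
  continuous f -> (forall x, is_derive x (1 : R) F (f x)) ->
  mu.-integrable `[0%R, +oo[ (EFin \o f) ->
  F x @[x --> +oo%R] --> l ->
  \int[mu]_(x in `[0%R, +oo[) f x = l - F 0.
Proof.
move=> cf dF intf Fl.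
have dF1 x : derivable F x 1 by have [] := dF x.
have cF : continuous F.
  by move=> x; exact/differentiable_continuous/derivable1_diffP.
have cv := Rintegral_itv_cvg intf cvgy_natrS.
have : F (n.+1%:R) - F 0 @[n --> \oo] --> l - F 0.
  apply: cvgB; last exact: cvg_cst.
  exact: (cvg_comp _ _ cvgy_natrS Fl).
apply: cvg_unique => //.
apply: cvg_trans cv; apply: near_eq_cvg; near=> n.
rewrite /Rintegral (@continuous_FTC2 _ f F)//.
- exact: continuous_subspaceT.
- split => //; first by apply: cvg_at_right_filter; exact: cF.
  by apply: cvg_at_left_filter; exact: cF.
- by move=> x _; rewrite derive1E; have [] := dF x.
Unshelve. all: by end_near. Qed.

(** F' may be unbounded at infinity, as it is for F(x) = sinh(x/2) below: the
    passage to the limit along compact intervals rests on the integrability of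
    both integrands. *)
Lemma Rintegral_subst0y (F F' G : R -> R) :
  {homo F : x y / x < y} -> (forall x, is_derive x (1 : R) F (F' x)) ->
  continuous F' -> F 0 = 0 -> F x @[x --> +oo%R] --> +oo%R -> continuous G ->
  mu.-integrable `[0%R, +oo[ (EFin \o G) ->
  mu.-integrable `[0%R, +oo[ (fun x => (G (F x) * F' x)%:E) ->
  \int[mu]_(x in `[0%R, +oo[) G x = \int[mu]_(x in `[0%R, +oo[) (G (F x) * F' x).
Proof.
move=> homF dF cF' F0 Foo cG intG intGF.
have dF1 x : derivable F x 1 by have [] := dF x.
have cF : continuous F.
  by move=> x; exact/differentiable_continuous/derivable1_diffP.
have F'E : derive1 F = F'.
  by apply/funext => x; rewrite derive1E; have [] := dF x.
have cv1 := Rintegral_itv_cvg intGF cvgy_natrS.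
have Fn : F (n.+1%:R) @[n --> \oo] --> +oo by exact: (cvg_comp _ _ cvgy_natrS Foo).
have cv2 := Rintegral_itv_cvg intG Fn.
apply: cvg_unique cv2 _ => //.
apply: cvg_trans cv1; apply: near_eq_cvg; near=> n.
rewrite /Rintegral.
have := @integration_by_substitution_increasing _ F G 0 n.+1%:R (ler0n _ _).
rewrite F0 => ->//.
- by rewrite F'E.
- by move=> x y _ _; exact: homF.
- by rewrite F'E => x _; exact: cF'.
- by rewrite F'E; apply/cvg_ex; exists (F' 0); apply: cvg_at_right_filter; exact: cF'.
- rewrite F'E; apply/cvg_ex; exists (F' n.+1%:R).
  by apply: cvg_at_left_filter; exact: cF'.
- split => //; first by apply: cvg_at_right_filter; exact: cF.
  by apply: cvg_at_left_filter; exact: cF.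
- exact: continuous_subspaceT.
Unshelve. all: by end_near. Qed.

End half_line.

(** * Derivatives of complex-valued functions of a real variable *)

Section cderivative.
Variable R : realType.
Implicit Types (f g : R -> R) (F G : R -> R[i]) (x : R).

Lemma is_derive_chain f g x df dg : is_derive (g x) (1 : R) f df ->
  is_derive x (1 : R) g dg -> is_derive x (1 : R) (fun y => f (g y)) (df * dg).
Proof.
move=> hf hg; have := @is_derive1_comp R f g x df dg hf hg.
by rewrite mulrC.
Qed.

(** Both components are differentiated separately, which is the form in which
    the real theorems use them. *)
Definition is_cderive F x (d : R[i]) :=
  is_derive x (1 : R) (fun y => complex.Re (F y)) (complex.Re d) /\
  is_derive x (1 : R) (fun y => complex.Im (F y)) (complex.Im d).

Lemma is_cderive_eq F x d d' : is_cderive F x d -> d = d' -> is_cderive F x d'.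
Proof. by move=> ? <-. Qed.

Lemma is_cderive_cst (c : R[i]) x : is_cderive (fun=> c) x 0.
Proof. by split => /=; exact: is_derive_cst. Qed.

Lemma is_cderive_real f x d : is_derive x (1 : R) f d ->
  is_cderive (fun y => (f y)%:C) x d%:C.
Proof. by split => //=; exact: is_derive_cst. Qed.

Lemma is_cderiveD F G x dF dG : is_cderive F x dF -> is_cderive G x dG ->
  is_cderive (fun y => F y + G y) x (dF + dG).
Proof.
move=> [F1 F2] [G1 G2]; split.
  by under eq_fun do rewrite Re_add; rewrite Re_add; exact: is_deriveD.
by under eq_fun do rewrite Im_add; rewrite Im_add; exact: is_deriveD.
Qed.

Lemma is_cderiveM F G x dF dG : is_cderive F x dF -> is_cderive G x dG ->
  is_cderive (fun y => F y * G y) x (dF * G x + F x * dG).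
Proof.
move=> [F1 F2] [G1 G2]; split.
  under eq_fun do rewrite Re_mul.
  by apply: is_derive_eq; rewrite !Re_ImE /GRing.scale/=; ring.
under eq_fun do rewrite Im_mul.
by apply: is_derive_eq; rewrite !Re_ImE /GRing.scale/=; ring.
Qed.

Lemma is_cderive_cexp F x d : is_cderive F x d ->
  is_cderive (fun y => cexp (F y)) x (d * cexp (F x)).
Proof.
move=> [F1 F2]; have dexp := is_derive_chain (is_derive_expR _) F1.
have dcos := is_derive_chain (is_derive_cos _) F2.
have dsin := is_derive_chain (is_derive_sin _) F2.
split => /=; apply: is_derive_eq; rewrite !Re_ImE /GRing.scale/=; ring.
Qed.

Lemma is_cderive_continuous F : (forall x, exists d, is_cderive F x d) ->
  continuous (fun x => complex.Re (F x)) /\ continuous (fun x => complex.Im (F x)).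
Proof.
move=> dF; split => x; have [d [d1 d2]] := dF x;
  apply: differentiable_continuous; apply/derivable1_diffP.
  by have [] := d1.
by have [] := d2.
Qed.

End cderivative.

(** * Domination by a Lorentzian *)

Section dominator.
Variable R : realType.
Local Notation mu := (@lebesgue_measure R).
Implicit Types (x : R).

(** One dominating function serves for all the integrands: it decays slower
    than any e^{kx - c cosh x} or e^{-c x^2}, and its integral over the line,
    pi, is also the constant of the Gaussian integral. *)
Definition lorentz x : R := (oneDsqr x)^-1.

Lemma oneDsqr_gt0 x : 0 < oneDsqr x.
Proof. exact: lt_le_trans ltr01 (oneDsqr_ge1 x). Qed.

Lemma lorentz_gt0 x : 0 < lorentz x.
Proof. by rewrite invr_gt0 oneDsqr_gt0. Qed.

Lemma integral0y_lorentz :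
  (\int[mu]_(x in `[0%R, +oo[) (lorentz x)%:E = (pi / 2)%:E)%E.
Proof.
rewrite (@ge0_continuous_FTC2y R lorentz (@atan R) 0 (pi / 2)).
- by rewrite atan0 sube0.
- by move=> x _; exact/ltW/lorentz_gt0.
- exact/continuous_subspaceT/continuous_oneDsqrV.
- exact: cvgy_atan.
- by move=> x _; exact: derivable_atan.
- by apply: cvg_at_right_filter; exact: continuous_atan.
- by move=> x _; rewrite derive1_atan.
Qed.

Lemma integralT_lorentz : (\int[mu]_x (lorentz x)%:E = pi%:E)%E.
Proof.
rewrite ge0_symfun_integralT; first last.
- by move=> x /=; rewrite /lorentz /oneDsqr sqrrN.
- exact: continuous_oneDsqrV.
- by move=> x; exact/ltW/lorentz_gt0.
by rewrite -set_itvcy integral0y_lorentz -EFinM; congr EFin; field.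
Qed.

Lemma measurable_lorentz : measurable_fun setT lorentz.
Proof. by apply: continuous_measurable_fun; exact: continuous_oneDsqrV. Qed.

Lemma integrable_lorentz : mu.-integrable setT (EFin \o lorentz).
Proof.
apply/integrableP; split.
  by apply/measurable_EFinP; exact: measurable_lorentz.
have -> : (\int[mu]_x `|(EFin \o lorentz) x| = \int[mu]_x (lorentz x)%:E)%E.
  apply: eq_integral => x _.
  by rewrite /= ger0_norm// ltW// lorentz_gt0.
by rewrite integralT_lorentz ltry.
Qed.

Lemma lorentz_le1 x : lorentz x <= 1.
Proof. by rewrite /lorentz invf_le1// oneDsqr_gt0. Qed.

Lemma cvg_lorentz : lorentz x @[x --> +oo%R] --> (0 : R).
Proof.
apply: (@squeeze_cvgr _ _ _ _ (fun=> 0) (fun x => x^-1)).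
- near=> x; have x1 : 1 <= x by near: x; exact: nbhs_pinfty_ge.
  have x0 : 0 < x by exact: lt_le_trans x1.
  rewrite ltW ?lorentz_gt0//= /lorentz lef_pV2 ?posrE ?oneDsqr_gt0//.
  by rewrite /oneDsqr ler_wpDl// expr2 ler_peMr// ltW.
- exact: cvg_cst.
- apply/gtr0_cvgV0; last exact: cvg_id.
  by near=> x; near: x; exact: nbhs_pinfty_gt.
Unshelve. all: by end_near. Qed.

(** e^|x| is the square of e^{|x|/2} >= 1 + |x|/2. *)
Lemma oneDsqr_le_expR x : oneDsqr x <= 4 * expR `|x|.
Proof.
have h : 1 + `|x| / 2 <= expR (`|x| / 2) by exact: expR_ge1Dx.
have -> : expR `|x| = expR (`|x| / 2) ^+ 2.
  by rewrite [RHS]expr2 -expRD; congr expR; field.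
have : (1 + `|x| / 2) ^+ 2 <= expR (`|x| / 2) ^+ 2.
  by rewrite ler_pXn2r// nnegrE ?expR_ge0// addr_ge0// divr_ge0.
have x0 : 0 <= `|x| by [].
rewrite /oneDsqr -[x ^+ 2]real_normK ?num_real//; nra.
Qed.

Lemma rcosh_ge_sqr x : x ^+ 2 / 8 <= rcosh x.
Proof.
have := oneDsqr_le_expR x; rewrite /oneDsqr /rcosh.
have := expR_gt0 x; have := expR_gt0 (- x).
have [x0|x0] := lerP 0 x.
  by rewrite ger0_norm//; lra.
by rewrite ltr0_norm//; lra.
Qed.

Lemma rcosh_ge1 x : 1 <= rcosh x.
Proof.
have h := expR_ge1Dx x; have h' := expR_ge1Dx (- x).
by rewrite /rcosh; lra.
Qed.

(** As cosh x >= x^2/8, the exponent (k + 1)|x| - c cosh x is bounded above,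
    by completing the square; the e^{-|x|} that is left over pays for
    1 + x^2. *)
Lemma cosh_decay (k c : R) : 0 < c ->
  exists C, forall x, expR (k * `|x| - c * rcosh x) <= C * lorentz x.
Proof.
move=> c0; exists (4 * expR (2 * (k + 1) ^+ 2 / c)) => x.
rewrite /lorentz ler_pdivlMr ?oneDsqr_gt0//.
have := oneDsqr_le_expR x => hx.
apply: (le_trans (ler_wpM2l (expR_ge0 _) hx)).
rewrite mulrCA ler_pM2l// -expRD ler_expR.
have h := rcosh_ge_sqr x.
have : c * (x ^+ 2 / 8) <= c * rcosh x by rewrite ler_pM2l.
suff : (k + 1) * `|x| <= 2 * (k + 1) ^+ 2 / c + c * (x ^+ 2 / 8).
  by move: h => /[swap]; lra.
have -> : x ^+ 2 = `|x| ^+ 2 by rewrite real_normK ?num_real.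
rewrite -subr_ge0.
rewrite (_ : _ - _ = (4 * (k + 1) - c * `|x|) ^+ 2 / (8 * c)); last first.
  by field; rewrite gt_eqF.
by rewrite divr_ge0 ?sqr_ge0// mulr_ge0// ltW.
Qed.

(** e^{c x^2} is the square of e^{c x^2/2} >= m (1 + x^2), where
    m = min(1, c/2).  Of the two factors 1 + x^2 so obtained, one gives the
    Lorentzian and the other absorbs 1 + |x|. *)
Lemma gauss_decay (c : R) : 0 < c ->
  exists C, forall x, (1 + `|x|) * expR (- (c * x ^+ 2)) <= C * lorentz x.
Proof.
move=> c0; pose m := Num.min 1 (c / 2).
have m0 : 0 < m by rewrite lt_min ltr01/= divr_gt0.
exists (2 / m ^+ 2) => x.
rewrite expRN /lorentz ler_pdivrMr ?expR_gt0// mulrAC ler_pdivlMr ?oneDsqr_gt0//.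
have h1 : 1 + c / 2 * x ^+ 2 <= expR (c / 2 * x ^+ 2) by exact: expR_ge1Dx.
have h2 : m * oneDsqr x <= expR (c / 2 * x ^+ 2).
  apply: le_trans h1; rewrite /oneDsqr mulrDr mulr1 lerD ?ge_min ?lexx//.
  by rewrite ler_wpM2r ?sqr_ge0// ge_min lexx orbT.
have h3 : m ^+ 2 * oneDsqr x ^+ 2 <= expR (c * x ^+ 2).
  have -> : expR (c * x ^+ 2) = expR (c / 2 * x ^+ 2) ^+ 2.
    by rewrite [RHS]expr2 -expRD; congr expR; field.
  by rewrite -exprMn ler_pXn2r// nnegrE ?expR_ge0// mulr_ge0 ?ltW ?oneDsqr_gt0.
have h4 : 1 + `|x| <= 2 * oneDsqr x.
  rewrite /oneDsqr -[x ^+ 2]real_normK ?num_real//.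
  have : 0 <= (`|x| - 1) ^+ 2 by rewrite sqr_ge0.
  have : 0 <= `|x| by []; nra.
apply: (@le_trans _ _ (2 / m ^+ 2 * (m ^+ 2 * oneDsqr x ^+ 2))); last first.
  by rewrite ler_pM2l// divr_gt0// exprn_gt0.
by rewrite mulrA divfK ?gt_eqF ?exprn_gt0// expr2 mulrA ler_pM2r// oneDsqr_gt0.
Qed.

Lemma cintegrable_le_lorentz (f : R -> R[i]) C : cmeas f ->
  (forall x, normc (f x) <= C * lorentz x) -> cintegrable mu f.
Proof.
move=> mf fC.
exact: (@cintegrable_dom _ _ _ mu f _ mf fC
  (integrableZl measurableT _ integrable_lorentz)).
Qed.

Lemma cvg_le_lorentz (g : R -> R) C :
  (forall x, `|g x| <= C * lorentz x) -> g x @[x --> +oo%R] --> (0 : R).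
Proof.
move=> gC; have h : C * lorentz x @[x --> +oo%R] --> (0 : R).
  by rewrite -(mulr0 C); apply: cvgM; [exact: cvg_cst|exact: cvg_lorentz].
apply: (@squeeze_cvgr _ _ _ _ (fun x => - (C * lorentz x)) (fun x => C * lorentz x)).
- by apply: nearW => x; rewrite -ler_norml.
- by rewrite -oppr0; exact: cvgN.
- exact: h.
Qed.

Lemma cintegral0y_FTC (f F : R -> R[i]) C :
  (forall x, is_cderive F x (f x)) -> (forall x, exists d, is_cderive f x d) ->
  cintegrable mu f -> (forall x, normc (F x) <= C * lorentz x) ->
  cintegral0y f = - F 0.
Proof.
move=> dF df [if1 if2] FC.
have [cf1 cf2] := is_cderive_continuous df.
have iS g : mu.-integrable setT g -> mu.-integrable `[0%R, +oo[ g.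
  by apply: integrableS.
apply: complex_ext.
  have /(_ 0) := @Rintegral_FTC2y _ _ (fun y => complex.Re (F y)) _ cf1
    (fun x => (dF x).1) (iS _ if1).
  rewrite Re_opp /= sub0r => -> //.
  by apply: (@cvg_le_lorentz _ C) => x; rewrite (le_trans (normc_Re _)).
have /(_ 0) := @Rintegral_FTC2y _ _ (fun y => complex.Im (F y)) _ cf2
  (fun x => (dF x).2) (iS _ if2).
rewrite Im_opp /= sub0r => -> //.
by apply: (@cvg_le_lorentz _ C) => x; rewrite (le_trans (normc_Im _)).
Qed.

End dominator.

(** * Complex integrals over the half-line *)

Section half_line_cint.
Variable R : realType.
Local Notation mu := (@lebesgue_measure R).
Implicit Types f g : R -> R[i].

Lemma cintegrable_indic (D : set (measurableTypeR R)) f : measurable D ->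
  cintegrable mu f -> cintegrable mu (fun x => (\1_D x)%:C * f x).
Proof.
move=> mD icf; have [i1 i2] := icf.
have mf : @cmeas _ (measurableTypeR R) R (fun x => (\1_D x)%:C * f x).
  by apply: cmeasM; [apply: cmeas_real|exact: cintegrable_cmeas icf].
have le x : normc ((\1_D x)%:C * f x) <= normc (f x).
  rewrite normcM normcR ger0_norm//.
  by rewrite ler_piMl ?normc_ge0// indicE; case: (_ \in _).
exact: (@cintegrable_dom _ (measurableTypeR R) R mu _ _ mf le
  (cintegrable_normc icf)).
Qed.

Lemma cintegral0yE f :
  cintegral0y f = cint mu (fun x => (\1_(`[0%R, +oo[%classic : set R) x)%:C * f x).
Proof.
by apply: complex_ext; rewrite /= Rintegral_mkcond; apply: eq_Rintegral => x _;
  rewrite ?Re_mul ?Im_mul/= mul0r ?subr0 ?addr0 patchE indicE;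
  case: (_ \in _); rewrite ?mul1r ?mul0r.
Qed.

(** Without the origin, the dilation by the variable of integration is
    invertible at every point of the domain. *)
Lemma cintegral0y_openE f : cintegrable mu f ->
  cintegral0y f = cint mu (fun x => (\1_(`]0%R, +oo[%classic : set R) x)%:C * f x).
Proof.
move=> [if1 if2].
have iS (g : R -> \bar R) : mu.-integrable setT g -> mu.-integrable `]0%R, +oo[ g.
  by apply: integrableS.
by apply: complex_ext; rewrite /= -Rintegral_itv_obnd_cbnd//; try exact: iS;
  rewrite Rintegral_mkcond; apply: eq_Rintegral => x _;
  rewrite ?Re_mul ?Im_mul/= mul0r ?subr0 ?addr0 patchE indicE;
  case: (_ \in _); rewrite ?mul1r ?mul0r.
Qed.

Lemma eq_cintegral0y f g : f =1 g -> cintegral0y f = cintegral0y g.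
Proof. by move=> fg; congr cintegral0y; exact/funext. Qed.

Lemma cintegral0yD f g : cintegrable mu f -> cintegrable mu g ->
  cintegral0y (fun x => f x + g x) = cintegral0y f + cintegral0y g.
Proof.
move=> icf icg; rewrite !cintegral0yE -cintD; last 2 first.
- exact: cintegrable_indic.
- exact: cintegrable_indic.
by apply: eq_cint => x; rewrite mulrDr.
Qed.

Lemma cintegral0yZ (c : R[i]) f : cintegrable mu f ->
  cintegral0y (fun x => c * f x) = c * cintegral0y f.
Proof.
move=> icf; rewrite !cintegral0yE -cintZ; last exact: cintegrable_indic.
by apply: eq_cint => x; rewrite mulrCA.
Qed.

Lemma cint_even f : cintegrable mu f -> (forall x, f (- x) = f x) ->
  cint mu f = 2%:R * cintegral0y f.
Proof.
move=> icf ef; rewrite cint_fold// -cintegral0yZ//.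
by apply: eq_cintegral0y => x; rewrite ef mulr_natl mulr2n.
Qed.

Lemma cint_lorentz (c : R[i]) : cint mu (fun x => c * (lorentz x)%:C) = c * pi%:C.
Proof.
rewrite cintZ; last first.
  by split => /=; [exact: integrable_lorentz|exact: integrable0].
congr (_ * _); apply: complex_ext => /=.
  by rewrite /Rintegral integralT_lorentz.
by rewrite /Rintegral integral0.
Qed.

Lemma cintegral0y_subst (F F' : R -> R) (G : R -> R[i]) :
  {homo F : x y / x < y} -> (forall x, is_derive x (1 : R) F (F' x)) ->
  continuous F' -> F 0 = 0 -> F x @[x --> +oo%R] --> +oo%R ->
  (forall x, exists d, is_cderive G x d) ->
  cintegrable mu G -> cintegrable mu (fun x => (F' x)%:C * G (F x)) ->
  cintegral0y G = cintegral0y (fun x => (F' x)%:C * G (F x)).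
Proof.
move=> homF dF cF' F0 Foo dG [G1 G2] [GF1 GF2].
have [cG1 cG2] := is_cderive_continuous dG.
have iS (g : R -> \bar R) : mu.-integrable setT g -> mu.-integrable `[0%R, +oo[ g.
  by apply: integrableS.
apply: complex_ext => /=.
  rewrite (Rintegral_subst0y homF dF cF' F0 Foo cG1).
  - by apply: eq_Rintegral => x _; rewrite Re_mul/= mul0r subr0 mulrC.
  - exact: iS.
  - by apply: iS; move: GF1; apply: eq_integrable => // x _;
      rewrite Re_mul/= mul0r subr0 mulrC.
rewrite (Rintegral_subst0y homF dF cF' F0 Foo cG2).
- by apply: eq_Rintegral => x _; rewrite Im_mul/= mul0r addr0 mulrC.
- exact: iS.
- by apply: iS; move: GF2; apply: eq_integrable => // x _;
    rewrite Im_mul/= mul0r addr0 mulrC.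
Qed.

End half_line_cint.

(** * The Gaussian integral with a complex parameter *)

Definition cgauss (R : realType) (w : R[i]) (s : R) : R[i] :=
  cexp (- (w * (s ^+ 2)%:C)).

Section gauss.
Variable R : realType.
Local Notation mu := (@lebesgue_measure R).
Variable w : R[i].
Hypothesis w0 : 0 < complex.Re w.
Local Notation w1 := (complex.Re w).
Local Notation phi := (cgauss w).

Lemma cmeas_cgauss : @cmeas _ (measurableTypeR R) R phi.
Proof.
apply: cmeas_cexp; apply: cmeasN; apply: cmeasM; first exact: cmeas_cst.
by apply: cmeas_real; exact: measurable_funX.
Qed.

Lemma normc_cgauss s : normc (phi s) = expR (- (w1 * s ^+ 2)).
Proof. by rewrite normc_cexp Re_opp Re_mul/= mulr0 subr0. Qed.

Lemma cintegrable_cgauss : cintegrable mu phi.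
Proof.
have [C HC] := gauss_decay w0; apply: (@cintegrable_le_lorentz _ _ C) => [|x].
  exact: cmeas_cgauss.
by rewrite normc_cgauss (le_trans _ (HC x))// ler_peMl ?expR_ge0// lerDl.
Qed.

Lemma is_cderive_cgauss x : is_cderive phi x (- (w * (2 * x)%:C) * phi x).
Proof.
apply: is_cderive_cexp.
apply: (@is_cderive_eq _ _ _ ((- w) * (2 * x)%:C)); last by rewrite mulNr.
rewrite (_ : (fun y => _) = (fun y => - w * (y ^+ 2)%:C)); last first.
  by apply/funext => y; rewrite mulNr.
apply: is_cderive_eq.
  apply: is_cderiveM; first exact: is_cderive_cst.
  apply: (@is_cderive_real _ _ _ (2 * x)).
  by apply: is_derive_eq; rewrite /GRing.scale/=; ring.
by rewrite mul0r add0r.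
Qed.

Lemma cintegrable_id_cgauss : cintegrable mu (fun s => s%:C * phi s).
Proof.
have [C HC] := gauss_decay w0; apply: (@cintegrable_le_lorentz _ _ C).
  by apply: cmeasM; [exact: cmeas_real|exact: cmeas_cgauss].
move=> x; rewrite normcM normcR normc_cgauss (le_trans _ (HC x))//.
by rewrite ler_pM2r ?expR_gt0// lerDr.
Qed.

(** The integrand has the primitive - e^{-w s^2} / (2w). *)
Lemma cintegral0y_id_cgauss :
  cintegral0y (fun s => s%:C * phi s) = (2%:R * w)^-1.
Proof.
have wn0 : w != 0 by apply: contraTneq w0 => ->; rewrite ltxx.
have [C HC] := gauss_decay w0.
have nle x : normc (phi x) <= C * lorentz x.
  by rewrite normc_cgauss (le_trans _ (HC x))// ler_peMl ?expR_ge0// lerDl.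
rewrite (@cintegral0y_FTC _ _ (fun s => - (2%:R * w)^-1 * phi s)
  (normc (- (2%:R * w)^-1) * C)).
- by rewrite /cgauss expr0n/= mulr0 oppr0 -[0]/(0%:C) cexpR expR0 mulr1 opprK.
- move=> x; apply: is_cderive_eq.
    by apply: is_cderiveM; [exact: is_cderive_cst|exact: is_cderive_cgauss].
  rewrite mul0r add0r rmorphM/= rmorph_nat; field.
  by rewrite ?wn0 ?pnatr_eq0.
- move=> x; eexists; apply: is_cderiveM; last exact: is_cderive_cgauss.
  by apply: is_cderive_real; exact: is_derive_id.
- exact: cintegrable_id_cgauss.
- by move=> x; rewrite normcM -mulrA ler_wpM2l// normc_ge0.
Qed.

End gauss.

Section gauss_square.
Variable R : realType.
Local Notation mu := (@lebesgue_measure R).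
Variable w : R[i].
Hypothesis w0 : 0 < complex.Re w.
Local Notation w1 := (complex.Re w).

Local Notation phi := (cgauss w).

Let I (s : R) : R := \1_(`]0%R, +oo[%classic : set R) s.

(** The integrand of the squared Gaussian after the substitution t = s v,
    cut off to s > 0. *)
Let h (s v : R) : R[i] := (I s * s)%:C * (phi s * phi (s * v)).

Let mI : measurable_fun setT (I : measurableTypeR R -> R).
Proof. exact: measurable_indic. Qed.

Let mphi := cmeas_cgauss w.

Let I_ge0 s : 0 <= I s. Proof. by rewrite /I indicE; case: (_ \in _). Qed.
Let I_le1 s : I s <= 1. Proof. by rewrite /I indicE; case: (_ \in _). Qed.
Let I_pos s : 0 < s -> I s = 1.
Proof. by move=> s0; rewrite /I indicE mem_set//= in_itv/= s0. Qed.
Let I_npos s : s <= 0 -> I s = 0.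
Proof.
by move=> s0; rewrite /I indicE memNset//= in_itv/= andbT; apply/negP; rewrite -leNgt.
Qed.

Let normc_phi := normc_cgauss w.

Let normc_phi_le : exists C, forall x, (1 + `|x|) * normc (phi x) <= C * lorentz x.
Proof.
have [C HC] := gauss_decay w0; exists C => x.
by rewrite normc_phi.
Qed.

Let iphi := cintegrable_cgauss w0.

Let mh : @cmeas _ (measurableTypeR R * measurableTypeR R)%type R
  (fun p => h p.1 p.2).
Proof.
have m1 : measurable_fun setT
    (fst : measurableTypeR R * measurableTypeR R -> R) by [].
have m2 : measurable_fun setT
    (snd : measurableTypeR R * measurableTypeR R -> R) by [].
apply: cmeasM.
  apply: cmeas_real; apply: measurable_funM => //.
  exact: (measurableT_comp mI m1).
by apply: cmeasM; apply: cmeas_cexp; apply: cmeasN; apply: cmeasM;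
  try exact: cmeas_cst; apply: cmeas_real; apply: measurable_funX => //;
  exact: measurable_funM.
Qed.

Let inner_s s : cint mu (h s) = (I s)%:C * phi s * cint mu phi.
Proof.
have [s0|s0] := leP s 0.
  rewrite (@eq_cint _ _ _ _ _ (fun=> 0 * 0)) => [|v].
    rewrite cintZ; last by split; exact: integrable0.
    by rewrite I_npos// !mul0r.
  by rewrite /h I_npos// !mul0r.
rewrite (@cint_affine _ s 0 phi) ?gt_eqF// gtr0_norm//.
have isc : cintegrable mu (fun v => phi (s * v + 0)).
  by apply: cintegrable_affine => //; rewrite gt_eqF.
rewrite mulrA -cintZ//; apply: eq_cint => v.
by rewrite /h addr0 I_pos// mul1r; ring.
Qed.

Let inner_v v : cint mu (h ^~ v) = (2%:R * w)^-1 * (lorentz v)%:C.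
Proof.
pose b := w * (oneDsqr v)%:C.
have b0 : 0 < complex.Re b.
  by rewrite Re_mul/= mulr0 subr0 mulr_gt0// oneDsqr_gt0.
have o0 : (oneDsqr v)%:C != 0 :> R[i].
  by rewrite fmorph_eq0 gt_eqF// oneDsqr_gt0.
have wn0 : w != 0 by apply: contraTneq w0 => ->; rewrite ltxx.
have <- : (2%:R * b)^-1 = (2%:R * w)^-1 * (lorentz v)%:C.
  by rewrite /lorentz fmorphV/= /b -invfM mulrA.
rewrite -(cintegral0y_id_cgauss b0) cintegral0y_openE.
  apply: eq_cint => s; rewrite /h rmorphM/= -mulrA; congr (_ * (_ * _)).
  rewrite /cgauss -cexpD; congr cexp.
  by rewrite /b /oneDsqr !(rmorphD, rmorphXn, rmorphM, rmorph1)/=; ring.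
exact: cintegrable_id_cgauss.
Qed.

(** Polar coordinates in disguise.  For every s > 0, the second factor of
    e^{-w s^2} e^{-w t^2} is integrated in the variable v = t/s.  After
    exchanging the integrals, the one over s is that of
    s e^{-w (1 + v^2) s^2}, which is elementary, and 1/(2w (1 + v^2)) remains
    to be integrated over v.  Squaring avoids the choice of a square root of
    w. *)
Lemma gauss_square : cintegral0y phi ^+ 2 = pi%:C / (4%:R * w).
Proof.
have wn0 : w != 0 by apply: contraTneq w0 => ->; rewrite ltxx.
have [C HC] := normc_phi_le.
have nphi_meas : measurable_fun setT ((fun s => normc (phi s)) : measurableTypeR R -> R).
  exact: cmeas_normc.
have inphi := cintegrable_normc iphi.
have inIphi : mu.-integrable setT (fun s => (I s * normc (phi s))%:E).
  apply: le_integrable inphi => //.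
    by apply/measurable_EFinP; exact: measurable_funM.
  move=> x _ /=; rewrite lee_fin ger0_norm ?mulr_ge0 ?normc_ge0//.
  by rewrite ger0_norm ?normc_ge0// ler_piMl ?normc_ge0.
pose A := \int[mu]_t normc (phi t).
have AE : (A%:E = \int[mu]_t (normc (phi t))%:E)%E.
  by rewrite /A /Rintegral fineK//; exact: integrable_fin_num.
have A0 : 0 <= A by apply: Rintegral_ge0 => t _; exact: normc_ge0.
have [] := @cfubini _ _ (measurableTypeR R) (measurableTypeR R) R mu mu h
    (fun s => A * (I s * normc (phi s))) mh.
- exact: (integrableZl measurableT A inIphi).
- move=> s; have [s0|s0] := leP s 0.
    rewrite I_npos// mul0r mulr0 (eq_integral (fun=> 0%E)) ?integral0//.
    by move=> v _; rewrite /h I_npos// !mul0r normcR normr0.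
  rewrite I_pos// mul1r [leRHS]EFinM AE.
  have AsE : (\int[mu]_t (normc (phi t))%:E =
      s%:E * \int[mu]_v (normc (phi (s * v + 0)))%:E)%E.
    rewrite -{1}(gtr0_norm s0); apply: ge0_integral_affine.
    - by rewrite gt_eqF.
    - exact: (measurable_int _ inphi).
    - by move=> x; rewrite lee_fin normc_ge0.
  rewrite AsE.
  rewrite muleAC -EFinM -ge0_integralZl//; last 3 first.
  + apply/measurable_EFinP.
    apply: (measurableT_comp nphi_meas (g := fun v => s * v + 0)) => //.
    by apply: measurable_funD => //; exact: measurable_funM.
  + by move=> x _; rewrite lee_fin normc_ge0.
  + by rewrite lee_fin mulr_ge0 ?normc_ge0// ltW.
  rewrite le_eqVlt; apply/orP; left; apply/eqP; apply: eq_integral => v _.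
  rewrite /h I_pos// mul1r !normcM normcR ger0_norm ?ltW// addr0 -EFinM.
  by rewrite mulrA.
- move=> v; apply: (@cintegrable_le_lorentz _ _ C).
    have [m1 m2] := mh; split.
      apply: (measurableT_comp m1 (g := fun x => (x, v))); exact: pair2_measurable.
    apply: (measurableT_comp m2 (g := fun x => (x, v))); exact: pair2_measurable.
  move=> s; rewrite !normcM normcR (le_trans _ (HC s))//.
  rewrite mulrA -[leRHS]mulr1 ler_pM ?mulr_ge0 ?normc_ge0//.
    rewrite ler_wpM2r ?normc_ge0// normrM ger0_norm//.
    by rewrite (le_trans (ler_piMl _ (I_le1 s)))// lerDr.
  by rewrite normc_phi -expR0 ler_expR oppr_le0 mulr_ge0 ?sqr_ge0// ltW.
move=> _ _ E.
have E1 := @eq_cint _ (measurableTypeR R) R mu _ _ inner_s.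
have E2 := @eq_cint _ (measurableTypeR R) R mu _ _ inner_v.
move: (etrans (esym E1) (etrans E E2)) => {E E1 E2}.
rewrite cint_lorentz.
rewrite (@eq_cint _ (measurableTypeR R) R mu _
  (fun s => cint mu phi * ((I s)%:C * phi s))); last first.
  by move=> s; rewrite mulrC.
rewrite cintZ; last exact: cintegrable_indic.
rewrite -cintegral0y_openE// cint_even//; last first.
  by move=> x; rewrite /cgauss sqrrN.
move=> E; rewrite expr2.
transitivity (2%:R^-1 * (2%:R * cintegral0y phi * cintegral0y phi)).
  by field; rewrite ?pnatr_eq0.
by rewrite E; field; rewrite ?wn0 ?pnatr_eq0.
Qed.

End gauss_square.

(** * The Macdonald function *)

Definition rsinh (R : realType) (x : R) : R := (expR x - expR (- x)) / 2.

Section hyperbolic.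
Variable R : realType.
Implicit Types x y : R.

Lemma is_derive_expRN x : is_derive x (1 : R) (fun y => expR (- y)) (- expR (- x)).
Proof. by apply: is_derive_eq; rewrite /GRing.scale/=; ring. Qed.

Lemma is_derive_rcosh x : is_derive x (1 : R) (@rcosh R) (rsinh x).
Proof.
have h1 := is_derive_expR x; have h2 := is_derive_expRN x.
apply: (is_derive_eq (f := fun y => (expR y + expR (- y)) * 2%:R^-1)).
by rewrite /rsinh /GRing.scale/=; field.
Qed.

Lemma is_derive_rsinh x : is_derive x (1 : R) (@rsinh R) (rcosh x).
Proof.
have h1 := is_derive_expR x; have h2 := is_derive_expRN x.
apply: (is_derive_eq (f := fun y => (expR y - expR (- y)) * 2%:R^-1)).
by rewrite /rcosh /GRing.scale/=; field.
Qed.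

Lemma is_derive_scale (a x : R) : is_derive x (1 : R) (fun y => a * y) a.
Proof. by apply: is_derive_eq; rewrite /GRing.scale/=; ring. Qed.

Lemma rcosh_half x : rcosh x = 1 + 2 * rsinh (x / 2) ^+ 2.
Proof.
rewrite /rcosh /rsinh; have -> : expR x = expR (x / 2) ^+ 2.
  by rewrite [RHS]expr2 -expRD; congr expR; field.
have -> : expR (- x) = expR (- (x / 2)) ^+ 2.
  by rewrite [RHS]expr2 -expRD; congr expR; field.
by rewrite expRN; field; rewrite gt_eqF// expR_gt0.
Qed.

Lemma lt_rsinh : {homo (@rsinh R) : x y / x < y}.
Proof.
by move=> x y xy; rewrite /rsinh ltr_pM2r//; apply: ltrB; rewrite ltr_expR// ltrN2.
Qed.

Lemma cvgy_rsinh : @rsinh R x @[x --> +oo%R] --> +oo%R.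
Proof.
apply: (ger_cvgy (f := fun x => x / 2)); last first.
  by apply: gt0_cvgMly => //; exact: cvg_id.
near=> x; rewrite /rsinh ler_pM2r//.
have x0 : 0 <= x by near: x; exact: nbhs_pinfty_ge.
have := expR_ge1Dx x; have : expR (- x) <= 1 by rewrite -expR0 ler_expR oppr_le0.
lra.
Unshelve. all: by end_near. Qed.

Lemma measurable_rcosh : measurable_fun setT (@rcosh R : measurableTypeR R -> R).
Proof.
apply: measurable_funM => //; apply: measurable_funD => //.
exact: measurableT_comp.
Qed.

End hyperbolic.

Definition macdonald_integrand (R : realType) (a : R) (w : R[i]) (x : R) : R[i] :=
  (rcosh (a * x))%:C * cexp (- (w * (rcosh x)%:C)).

(** Real orders suffice: those that occur are integers or half-integers. *)
HB.lock Definition macdonald (R : realType) (a : R) (w : R[i]) : R[i] :=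
  cintegral0y (macdonald_integrand a w).

Section bessel.
Variable R : realType.
Local Notation mu := (@lebesgue_measure R).
Implicit Types (a x : R) (w : R[i]).

Definition expcosh a w x : R[i] := (expR (a * x))%:C * cexp (- (w * (rcosh x)%:C)).

Lemma macdonaldE a w : macdonald a w = cintegral0y (macdonald_integrand a w).
Proof. by rewrite unlock. Qed.

Lemma besselK_macdonald a w : besselK a%:C w = macdonald a w.
Proof.
by rewrite macdonaldE; apply: eq_cintegral0y => x; rewrite -rmorphM/= ccoshR mulrC.
Qed.

Lemma cmeas_cexp_cosh w :
  @cmeas _ (measurableTypeR R) R (fun x => cexp (- (w * (rcosh x)%:C))).
Proof.
apply: cmeas_cexp; apply: cmeasN; apply: cmeasM; first exact: cmeas_cst.
by apply: cmeas_real; exact: measurable_rcosh.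
Qed.

Lemma cmeas_expcosh a w : @cmeas _ (measurableTypeR R) R (expcosh a w).
Proof.
apply: cmeasM; last exact: cmeas_cexp_cosh.
by apply: cmeas_real; apply: measurableT_comp => //; exact: measurable_funM.
Qed.

Lemma normc_expcosh a w x :
  normc (expcosh a w x) = expR (a * x - complex.Re w * rcosh x).
Proof.
rewrite normcM normcR normc_cexp Re_opp Re_mul/= mulr0 subr0.
by rewrite ger0_norm ?expR_ge0// -expRD.
Qed.

Lemma expcosh_decay a w : 0 < complex.Re w ->
  exists C, forall x, normc (expcosh a w x) <= C * lorentz x.
Proof.
move=> w0; have [C HC] := cosh_decay `|a| w0; exists C => x.
rewrite normc_expcosh (le_trans _ (HC x))// ler_expR lerD2r -normrM.
exact: ler_norm.
Qed.

Lemma cintegrable_expcosh a w : 0 < complex.Re w -> cintegrable mu (expcosh a w).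
Proof.
move=> w0; have [C HC] := expcosh_decay a w0.
by apply: cintegrable_le_lorentz HC; exact: cmeas_expcosh.
Qed.

Lemma macdonald_integrandE a w x :
  macdonald_integrand a w x = 2%:R^-1 * (expcosh a w x + expcosh (- a) w x).
Proof.
rewrite /macdonald_integrand /expcosh /rcosh rmorphM rmorphD/= fmorphV rmorph_nat mulNr.
ring.
Qed.

Lemma cintegrable_macdonald_integrand a w : 0 < complex.Re w ->
  cintegrable mu (macdonald_integrand a w).
Proof.
move=> w0; rewrite (_ : macdonald_integrand a w = fun x =>
  2%:R^-1 * (expcosh a w x + expcosh (- a) w x)); last first.
  by apply/funext => x; exact: macdonald_integrandE.
by apply: cintegrableZ; apply: cintegrableD; exact: cintegrable_expcosh.
Qed.

(** On the whole line cosh(ax) may be replaced with e^{ax}, which differs from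
    it by an odd function.  Exponentials are what the rotation of the plane
    separates. *)
Lemma cint_expcosh a w : 0 < complex.Re w ->
  cint mu (expcosh a w) = 2%:R * macdonald a w.
Proof.
move=> w0; rewrite cint_fold; last exact: cintegrable_expcosh.
rewrite macdonaldE -cintegral0yZ; last exact: cintegrable_macdonald_integrand.
apply: eq_cintegral0y => x; rewrite macdonald_integrandE mulVKf ?pnatr_eq0//.
by rewrite /expcosh rcoshN mulrN mulNr.
Qed.

Lemma macdonaldN a w : macdonald (- a) w = macdonald a w.
Proof.
by rewrite !macdonaldE; apply: eq_cintegral0y => x; rewrite /macdonald_integrand mulNr rcoshN.
Qed.

Lemma is_cderive_cexp_cosh w x :
  is_cderive (fun x => cexp (- (w * (rcosh x)%:C))) x
    (- (w * (rsinh x)%:C) * cexp (- (w * (rcosh x)%:C))).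
Proof.
apply: is_cderive_cexp.
rewrite (_ : (fun y => _) = (fun y => - w * (rcosh y)%:C)); last first.
  by apply/funext => y; rewrite mulNr.
apply: is_cderive_eq.
  apply: is_cderiveM; first exact: is_cderive_cst.
  exact: (is_cderive_real (is_derive_rcosh x)).
by rewrite mul0r add0r mulNr.
Qed.

Lemma is_cderive_macdonald_integrand a w x : exists d, is_cderive (macdonald_integrand a w) x d.
Proof.
eexists; apply: is_cderiveM; last exact: is_cderive_cexp_cosh.
exact: (is_cderive_real (is_derive_chain (is_derive_rcosh _) (is_derive_scale a x))).
Qed.

(** The function sinh(ax) e^{-w cosh x} vanishes at 0 and at infinity, so that
    its derivative has integral 0; in this derivative, sinh(x) sinh(ax) is
    half the difference of cosh((a + 1)x) and cosh((a - 1)x). *)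
Lemma macdonald_recurrence a w : 0 < complex.Re w ->
  macdonald (a + 1) w = macdonald (a - 1) w + (2 * a)%:C / w * macdonald a w.
Proof.
move=> w0; have wn0 : w != 0 by apply: contraTneq w0 => ->; rewrite ltxx.
pose f x := a%:C * macdonald_integrand a w x +
  ((- (w / 2%:R)) * macdonald_integrand (a + 1) w x + w / 2%:R * macdonald_integrand (a - 1) w x).
pose F x := (rsinh (a * x))%:C * cexp (- (w * (rcosh x)%:C)).
have i b := cintegrable_macdonald_integrand b w0.
have iZ c b := cintegrableZ c (i b).
suff : cintegral0y f = 0.
  rewrite cintegral0yD; [|exact: iZ|by apply: cintegrableD; exact: iZ].
  rewrite cintegral0yD; [|exact: iZ|exact: iZ].
  rewrite !cintegral0yZ// -!macdonaldE => E.
  apply/eqP; rewrite -subr_eq0; apply/eqP.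
  transitivity (- (2%:R / w) * (a%:C * macdonald a w +
      (- (w / 2%:R) * macdonald (a + 1) w + w / 2%:R * macdonald (a - 1) w))).
    by rewrite rmorphM/= rmorph_nat; field.
  by rewrite E mulr0.
have [C1 H1] := expcosh_decay a w0.
have [C2 H2] := expcosh_decay (- a) w0.
rewrite (@cintegral0y_FTC _ f F (C1 + C2)).
- by rewrite /F mulr0 /rsinh oppr0 subrr mul0r mul0r oppr0.
- move=> x; apply: is_cderive_eq.
    apply: is_cderiveM; last exact: is_cderive_cexp_cosh.
    exact: (is_cderive_real (is_derive_chain (is_derive_rsinh _) (is_derive_scale a x))).
  have -> : f x = (a * rcosh (a * x))%:C * cexp (- (w * (rcosh x)%:C)) -
      w * ((rcosh ((a + 1) * x) - rcosh ((a - 1) * x)) / 2)%:C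
        * cexp (- (w * (rcosh x)%:C)).
    rewrite /f /macdonald_integrand !(rmorphM, rmorphB)/= fmorphV rmorph_nat; ring.
  have -> : (rcosh ((a + 1) * x) - rcosh ((a - 1) * x)) / 2 =
      rsinh (a * x) * rsinh x.
    by rewrite /rcosh /rsinh !mulrDl !mulNr !mul1r !opprD !opprK !expRD; field.
  by rewrite !rmorphM/=; ring.
- move=> x; rewrite /f.
  have [d0 D0] := is_cderive_macdonald_integrand a w x.
  have [d1 D1] := is_cderive_macdonald_integrand (a + 1) w x.
  have [d2 D2] := is_cderive_macdonald_integrand (a - 1) w x.
  by eexists; apply: is_cderiveD; [|apply: is_cderiveD];
    (apply: is_cderiveM; [exact: is_cderive_cst|eassumption]).
- by apply: cintegrableD => //; exact: cintegrableD.
- move=> x; apply: (@le_trans _ _ (normc (expcosh a w x) + normc (expcosh (- a) w x))).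
    rewrite /expcosh !normcM !normcR -mulrDl ler_wpM2r ?normc_ge0//.
    have e1 := expR_gt0 (a * x); have e2 := expR_gt0 (- a * x).
    rewrite (gtr0_norm e1) (gtr0_norm e2) /rsinh -mulNr ler_norml; apply/andP; split; lra.
  by rewrite mulrDl lerD.
Qed.

(** With s = sinh(x/2) one has cosh x = 1 + 2 s^2 and 2 ds = cosh(x/2) dx:
    the integral of order 1/2 is a Gaussian one. *)
Lemma macdonald_half_square w : 0 < complex.Re w ->
  macdonald (2%:R^-1) w ^+ 2 = pi%:C * cexp (- (2%:R * w)) / (2%:R * w).
Proof.
move=> w0.
have ww0 : 0 < complex.Re (2%:R * w).
  by rewrite mulr_natl mulr2n Re_add addr_gt0.
have wn0 : w != 0 by apply: contraTneq w0 => ->; rewrite ltxx.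
pose G s := cexp (- w) * cgauss (2%:R * w) s.
pose F x : R := rsinh (2^-1 * x).
have GFE x : (2^-1 * rcosh (2^-1 * x))%:C * G (F x) = 2%:R^-1 * macdonald_integrand 2^-1 w x.
  rewrite /G /cgauss /F /macdonald_integrand -cexpD (rcosh_half x) [x / 2]mulrC.
  rewrite rmorphM/= fmorphV rmorph_nat -[LHS]mulrA; congr (_ * (_ * cexp _)).
  set q := rsinh _ ^+ 2; clearbody q.
  by rewrite rmorphD rmorphM/= rmorph1 rmorph_nat; ring.
have iG : cintegrable mu G by apply: cintegrableZ; exact: cintegrable_cgauss.
have icc := cintegrable_macdonald_integrand 2^-1 w0.
have : cintegral0y G = cintegral0y (fun x => (2^-1 * rcosh (2^-1 * x))%:C * G (F x)).
  apply: cintegral0y_subst => //.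
  - by move=> x y xy; apply: lt_rsinh; rewrite ltr_pM2l.
  - move=> x; rewrite mulrC.
    exact: (is_derive_chain (is_derive_rsinh _) (is_derive_scale _ _)).
  - move=> x; apply: cvgM; first exact: cvg_cst.
    apply: (@continuous_comp _ _ _ (fun x => 2^-1 * x) (@rcosh R)).
      by apply: cvgM; [exact: cvg_cst|exact: cvg_id].
    apply: differentiable_continuous; apply/derivable1_diffP.
    by have [] := is_derive_rcosh (2^-1 * x).
  - by rewrite /F mulr0 /rsinh oppr0 subrr mul0r.
  - apply: (cvg_comp (fun x => 2^-1 * x) (@rsinh R)); last exact: cvgy_rsinh.
    by apply: gt0_cvgMry => //; exact: cvg_id.
  - move=> x; eexists; apply: is_cderiveM; first exact: is_cderive_cst.
    exact: is_cderive_cgauss.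
  - by under eq_fun do rewrite GFE; exact: cintegrableZ.
rewrite (eq_cintegral0y GFE) !cintegral0yZ//; last exact: cintegrable_cgauss.
rewrite -macdonaldE => E.
have -> : macdonald 2^-1 w = 2%:R * (2%:R^-1 * macdonald 2^-1 w) by rewrite mulVKf// pnatr_eq0.
rewrite -E !exprMn gauss_square// mulrCA mulrA.
rewrite [cexp (- w) ^+ 2]expr2 -cexpD -opprD -mulr2n -[w *+ 2]mulr_natl.
by field; rewrite ?wn0 ?pnatr_eq0.
Qed.

End bessel.

(** * The product formula *)

Section product_formula.
Variable R : realType.
Local Notation mu := (@lebesgue_measure R).

(** The shear b is 0 in the variables (t, u) of the double integral and 1 in
    the variables (t, t + u). *)
Lemma lorentz_fubini (b C : R) (f : R -> R -> R[i]) :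
  @cmeas _ (measurableTypeR R * measurableTypeR R)%type R (fun p => f p.1 p.2) ->
  (forall t x, normc (f t x) <= C * (lorentz t * lorentz (x - b * t))) ->
  cintegrable mu (fun t => cint mu (f t)) /\
  cint mu (fun t => cint mu (f t)) = cint mu (fun x => cint mu (f ^~ x)).
Proof.
move=> mf fC.
have C0 : 0 <= C.
  have := le_trans (normc_ge0 _) (fC 0 0).
  by rewrite pmulr_lge0// mulr_gt0// lorentz_gt0.
have mlor : measurable_fun setT (@lorentz R : measurableTypeR R -> R).
  exact: measurable_lorentz.
have l0 x : 0 <= lorentz x :> R by rewrite ltW// lorentz_gt0.
have [|||_ H1 H2] := @cfubini _ _ (measurableTypeR R) (measurableTypeR R) R mu mu f
    (fun t => (C * pi) * lorentz t) mf; last by split.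
- exact: (integrableZl measurableT (C * pi) (@integrable_lorentz R)).
- move=> t.
  have pitE : (pi%:E = \int[mu]_x (lorentz (x - b * t))%:E)%E.
    rewrite -integralT_lorentz.
    rewrite (@ge0_integral_affine _ 1 (- (b * t)) (oner_neq0 _) (fun x => (lorentz x)%:E)).
    + by rewrite normr1 mul1e; apply: eq_integral => x _; rewrite mul1r.
    + exact: (measurable_int _ (@integrable_lorentz R)).
    + by move=> x; rewrite lee_fin.
  have mshift : measurable_fun setT
      ((fun x => (lorentz (x - b * t))%:E) : measurableTypeR R -> \bar R).
    have msub : measurable_fun setT
        ((fun x => x - b * t) : measurableTypeR R -> measurableTypeR R).
      exact: measurable_funD.
    by apply/measurable_EFinP; exact: (measurableT_comp mlor msub).
  rewrite mulrAC EFinM pitE -ge0_integralZl//.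
  + apply: ge0_le_integral => //.
    * by move=> x _; rewrite lee_fin normc_ge0.
    * apply/measurable_EFinP.
      exact: (measurableT_comp (cmeas_normc mf) (pair1_measurable t)).
    * exact: measurable_funeM.
    * by move=> x _; rewrite -EFinM lee_fin -mulrA fC.
  + by move=> x _; rewrite lee_fin.
  + by rewrite lee_fin mulr_ge0.
- move=> x; apply: (@cintegrable_le_lorentz _ _ C).
    have [m1 m2] := mf; split.
      exact: (measurableT_comp m1 (pair2_measurable x)).
    exact: (measurableT_comp m2 (pair2_measurable x)).
  move=> t; rewrite (le_trans (fC t x))// ler_wpM2l// ler_piMr//.
  exact: lorentz_le1.
Qed.

(** The integrand of the double integral, with e^{jt} and e^{nu u} in place of
    the hyperbolic cosines. *)
Definition planar (j nu : R) (z : R[i]) (t u : R) : R[i] :=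
  (expR (j * t))%:C * expcosh nu (z * (rcosh t)%:C) u.

Variables (j nu : R) (z : R[i]).
Hypothesis z0 : 0 < complex.Re z.
Local Notation w := (z / 2%:R).

Let w0 : 0 < complex.Re w.
Proof.
have -> : w = z * (2^-1)%:C by rewrite fmorphV rmorph_nat.
by rewrite Re_mul/= mulr0 subr0 mulr_gt0.
Qed.

Let planar_decay : exists C, forall t u,
  normc (planar j nu z t u) <= C * (lorentz t * lorentz u).
Proof.
have [C1 H1] := expcosh_decay j w0; have [C2 H2] := expcosh_decay nu w0.
exists (C1 * C2) => t u; rewrite mulrACA.
apply: (@le_trans _ _ (normc (expcosh j w t) * normc (expcosh nu w u))); last first.
  by rewrite ler_pM ?normc_ge0.
rewrite /planar normcM normcR !normc_expcosh (ger0_norm (expR_ge0 _)) -!expRD.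
rewrite ler_expR Re_mul/= mulr0 subr0.
have -> : complex.Re w = complex.Re z / 2.
  have -> : w = z * (2^-1)%:C by rewrite fmorphV rmorph_nat.
  by rewrite Re_mul/= mulr0 subr0.
have c1 := rcosh_ge1 t; have c2 := rcosh_ge1 u.
(* 2 (a b) >= a + b for a, b >= 1: the decay splits between t and u *)
suff : complex.Re z * ((rcosh t + rcosh u) / 2) <= complex.Re z * (rcosh t * rcosh u).
  by rewrite mulrDl mulrDr mulrA; lra.
by rewrite ler_pM2l//; nra.
Qed.

Let cmeas_planar (g : measurableTypeR R * measurableTypeR R -> R) :
  measurable_fun setT g ->
  @cmeas _ (measurableTypeR R * measurableTypeR R)%type R
    (fun p => planar j nu z p.1 (g p)).
Proof.
move=> mg; have m1 : measurable_fun setT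
    (fst : measurableTypeR R * measurableTypeR R -> R) by [].
apply: cmeasM.
  by apply: cmeas_real; apply: measurableT_comp => //; exact: measurable_funM.
apply: cmeasM.
  by apply: cmeas_real; apply: measurableT_comp => //; exact: measurable_funM.
apply: cmeas_cexp; apply: cmeasN; apply: cmeasM.
  apply: cmeasM; first exact: cmeas_cst.
  by apply: cmeas_real; exact: (measurableT_comp (@measurable_rcosh R) m1).
by apply: cmeas_real; exact: (measurableT_comp (@measurable_rcosh R) mg).
Qed.

Let cmeas_planar_shift : @cmeas _ (measurableTypeR R * measurableTypeR R)%type R
  (fun p => planar j nu z p.1 (p.2 - 1 * p.1)).
Proof.
by apply: cmeas_planar; apply: measurable_funB => //; exact: measurable_funM.
Qed.

Lemma cintegrable_planar : cintegrable mu (fun t => cint mu (planar j nu z t)).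
Proof.
have [C HC] := planar_decay.
have m2 : @cmeas _ (measurableTypeR R * measurableTypeR R)%type R
  (fun p => planar j nu z p.1 p.2) by exact: cmeas_planar.
have HC' t u : normc (planar j nu z t u) <= C * (lorentz t * lorentz (u - 0 * t)).
  by rewrite (mul0r t) subr0.
by have [] := lorentz_fubini m2 HC'.
Qed.

(** For t = (x + y)/2 and u = (x - y)/2 one has
    2 cosh t cosh u = cosh x + cosh y, so that the integrand separates. *)
Lemma planar_rotate x y :
  planar j nu z (2^-1 * y + x / 2) (x - 1 * (2^-1 * y + x / 2)) =
  expcosh ((j + nu) / 2) w x * expcosh ((j - nu) / 2) w y.
Proof.
set t := 2^-1 * y + x / 2.
have -> : x - 1 * t = x / 2 - y / 2 by rewrite /t; field.
have -> : t = x / 2 + y / 2 by rewrite /t; field.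
rewrite /planar /expcosh mulrA -rmorphM/= -expRD.
rewrite mulrACA -rmorphM/= -expRD -cexpD; congr ((expR _)%:C * cexp _).
  by field.
rewrite -mulrA -rmorphM/= -opprD -mulrDr -rmorphD/=.
have -> : rcosh (x / 2 + y / 2) * rcosh (x / 2 - y / 2) = (rcosh x + rcosh y) / 2.
  rewrite /rcosh !opprD !opprK !expRD.
  have e (a : R) : expR a = expR (a / 2) * expR (a / 2).
    by rewrite -expRD; congr expR; field.
  rewrite (e x) (e (- x)) (e y) (e (- y)) !mulNr.
  have hx : expR (x / 2) * expR (- (x / 2)) = 1 by rewrite -expRD subrr expR0.
  have hy : expR (y / 2) * expR (- (y / 2)) = 1 by rewrite -expRD subrr expR0.
  move: (expR (x / 2)) (expR (- (x / 2))) (expR (y / 2)) (expR (- (y / 2))) hx hy.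
  move=> P P' Q Q' hx hy.
  transitivity ((P * P * (Q * Q') + (P * P') * (Q * Q) + (P * P') * (Q' * Q')
    + P' * P' * (Q * Q')) / 4); first by field.
  by rewrite hx hy; field.
by rewrite rmorphM/= fmorphV rmorph_nat; congr (- _); ring.
Qed.

(** The rotation of the plane is carried out one variable at a time: first
    u = x - t at fixed t and then, once the integrals are exchanged,
    t = (x + y)/2 at fixed x.  The latter accounts for a factor 1/2, against
    the two factors 2 which come from integrating over whole lines. *)
Lemma cint_planar : cint mu (fun t => cint mu (planar j nu z t)) =
  2%:R * (macdonald ((j + nu) / 2) w * macdonald ((j - nu) / 2) w).
Proof.
have [C HC] := planar_decay.
have [C2 HC2] := expcosh_decay nu w0.
have [] := @lorentz_fubini 1 C (fun t u => planar j nu z t (u - 1 * t)) cmeas_planar_shift.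
  by move=> t u; rewrite (le_trans (HC _ _)).
have ip t : cintegrable mu (planar j nu z t).
  apply: cintegrableZ; apply: cintegrable_expcosh.
  by rewrite Re_mul/= mulr0 subr0 mulr_gt0// rcosh_gt0.
have E1 t : cint mu (planar j nu z t) = cint mu (fun u => planar j nu z t (u - 1 * t)).
  rewrite (@cint_affine _ 1 (- (1 * t)) _ (oner_neq0 _) (ip t)) normr1 rmorph1 [LHS]mul1r.
  by apply: (@eq_cint _ (measurableTypeR R)) => u; rewrite mul1r.
move=> _ E; rewrite (@eq_cint _ (measurableTypeR R) R mu _ _ E1) E => {E E1}.
have hn0 : (2^-1 : R) != 0 by rewrite invr_neq0.
set a := (j + nu) / 2; set b := (j - nu) / 2.
have E2 x : cint mu (fun t => planar j nu z t (x - 1 * t)) = macdonald b w * expcosh a w x.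
  rewrite (@cint_affine _ 2^-1 (x / 2) _ hn0); last first.
    apply: (@cintegrable_le_lorentz _ _ C).
      have [m1 m2] := cmeas_planar_shift; split.
        exact: (measurableT_comp m1 (pair2_measurable x)).
      exact: (measurableT_comp m2 (pair2_measurable x)).
    move=> t; rewrite (le_trans (HC _ _))//.
    have C0 : 0 <= C.
      have := le_trans (normc_ge0 _) (HC 0 0).
      by rewrite pmulr_lge0// mulr_gt0// lorentz_gt0.
    by rewrite ler_wpM2l// ler_piMr ?lorentz_le1// ltW// lorentz_gt0.
  rewrite (@eq_cint _ (measurableTypeR R) R mu _ _ (planar_rotate x)).
  rewrite cintZ; last exact: cintegrable_expcosh.
  rewrite cint_expcosh// gtr0_norm// fmorphV rmorph_nat -/a -/b.
  by field.
rewrite (@eq_cint _ (measurableTypeR R) R mu _ _ E2) cintZ; last exact: cintegrable_expcosh.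
by move: (macdonald a w) (macdonald b w) (cint_expcosh a w0) => x y ->; rewrite mulrCA [y * x]mulrC.
Qed.

End product_formula.

(** * Bessel polynomials and symmetric sums *)

Section bessel_poly.
Variable F : numFieldType.
Implicit Types (N r p : nat) (y : F).

(** The polynomial factor of the Macdonald function of half-integer order:
    K_{N + 1/2}(w) / K_{1/2}(w) is its value at 1/(2w). *)
Definition besselPoly N : {poly F} := \poly_(r < N.+1) betaCoef F N r.

Lemma coef_besselPoly N r : (besselPoly N)`_r = betaCoef F N r.
Proof.
rewrite coef_poly ltnS; case: ifPn => // nr.
by rewrite /betaCoef (negbTE nr).
Qed.

Lemma betaCoef0 N : betaCoef F N 0 = 1.
Proof.
by rewrite /betaCoef leq0n addn0 subn0 fact0 mul1r divff// pnatr_eq0 -lt0n fact_gt0.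
Qed.

Lemma betaCoefE s q : betaCoef F (s + q) s =
  ((s + q + s)`!)%:R / ((s`!)%:R * (q`!)%:R).
Proof. by rewrite /betaCoef leq_addr addKn. Qed.

Lemma betaCoef_gt N r : (N < r)%N -> betaCoef F N r = 0.
Proof. by rewrite /betaCoef ltnNge => /negbTE ->. Qed.

(** When q = N - r - 1 is a natural number, clearing the factorials leaves
    (2r + q + 4)(2r + q + 3) = (q + 1)(q + 2) + 2 (2N + 3)(r + 1).  For
    r = N and r = N + 1 the first coefficient on the right is 0, and for
    larger r all of them are. *)
Lemma betaCoef_rec N r : betaCoef F N.+2 r.+1 =
  betaCoef F N r.+1 + (2 * (2 * N + 3))%:R * betaCoef F N.+1 r.
Proof.
have fn0 k : (k`!)%:R != 0 :> F by rewrite pnatr_eq0 -lt0n fact_gt0.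
have S1 k : 1 + k%:R != 0 :> F by rewrite nat1r pnatr_eq0.
have S2 k : 2 + k%:R != 0 :> F by rewrite -natrD pnatr_eq0.
have bE n i q u : n = (i + q)%N -> (i + q + i)%N = u ->
    betaCoef F n i = (u`!)%:R / ((i`!)%:R * (q`!)%:R).
  by move=> -> <-; exact: betaCoefE.
have [rN|] := leqP r.+1 N.
  have [q Nq] : exists q, N = (r.+1 + q)%N by exists (N - r.+1)%N; rewrite subnKC.
  rewrite (bE _ _ q.+2 (r + r + q).+4); [|lia|lia].
  rewrite (bE _ _ q (r + r + q).+2); [|lia|lia].
  rewrite (bE _ _ q.+2 (r + r + q).+2); [|lia|lia].
  rewrite Nq !factS !natrM.
  field.
  by rewrite ?fn0 ?S1 ?S2.
rewrite ltnS leq_eqVlt => /orP[/eqP <-|].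
  rewrite [betaCoef F N _]betaCoef_gt// add0r.
  rewrite (bE _ _ 1%N (N + N).+3); [|lia|lia].
  rewrite (bE _ _ 1%N (N + N).+1); [|lia|lia].
  rewrite !factS !natrM.
  field.
  by rewrite ?fn0 ?S1 ?S2.
rewrite leq_eqVlt => /orP[/eqP <-|Nr].
  rewrite [betaCoef F N _]betaCoef_gt// add0r.
  rewrite (bE _ _ 0%N (N + N).+4); [|lia|lia].
  rewrite (bE _ _ 0%N (N + N).+2); [|lia|lia].
  rewrite !factS !natrM.
  field.
  by rewrite ?fn0 ?S1 ?S2.
by rewrite !betaCoef_gt ?mulr0 ?addr0//; lia.
Qed.

Lemma besselPoly0 : besselPoly 0 = 1.
Proof.
apply/polyP => i; rewrite coef_besselPoly coef1; case: i => [|i].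
  by rewrite betaCoef0.
by rewrite betaCoef_gt.
Qed.

Lemma besselPoly1 : besselPoly 1 = 1 + 2%:R *: 'X.
Proof.
apply/polyP => i; rewrite coef_besselPoly coefD coefZ coefX coef1.
case: i => [|[|i]] /=; first by rewrite betaCoef0 mulr0 addr0.
  by rewrite /betaCoef/= !mulr1 add0r divr1.
by rewrite betaCoef_gt// mulr0 addr0.
Qed.

Lemma besselPoly_rec N : besselPoly N.+2 =
  besselPoly N + (2 * (2 * N + 3))%:R *: ('X * besselPoly N.+1).
Proof.
apply/polyP => -[|i]; rewrite coefD coefZ coefXM !coef_besselPoly/=.
  by rewrite !betaCoef0 mulr0 addr0.
exact: betaCoef_rec.
Qed.

(** A Cauchy product: P exceeds the degree A + B, so nothing is truncated. *)
Lemma convCoef_horner A B P y : (A + B < P)%N ->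
  \sum_(p < P) convCoef (betaCoef F A) (betaCoef F B) p * y ^+ p =
  (besselPoly A).[y] * (besselPoly B).[y].
Proof.
move=> ABP; rewrite -hornerM (@horner_coef_wide _ P).
  apply: eq_bigr => p _; rewrite coefM; congr (_ * _).
  by apply: eq_bigr => r _; rewrite !coef_besselPoly.
rewrite (leq_trans (size_polyMleq _ _))//.
have hA : (size (besselPoly A) <= A.+1)%N by exact: size_poly.
have hB : (size (besselPoly B) <= B.+1)%N by exact: size_poly.
by rewrite -subn1 leq_subLR (leq_trans (leq_add hA hB))//; lia.
Qed.

Lemma psum_exchange n P (f : nat -> nat -> F) (g : nat -> F) :
  \sum_(p < P) psum n (f p) * g p = psum n (fun k => \sum_(p < P) f p k * g p).
Proof.
rewrite /psum exchange_big/= mulr_suml -big_split/=; apply: eq_bigr => p _.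
by rewrite mulrDl mulr_suml mulrAC.
Qed.

Lemma eq_psum n (f g : nat -> F) : (forall k, (k <= n)%N -> f k = g k) ->
  psum n f = psum n g.
Proof.
move=> fg; rewrite /psum fg//; congr (_ + _); apply: eq_bigr => k _.
by rewrite fg// ltnW.
Qed.

Lemma psumZ n (c : F) (f : nat -> F) : psum n (fun k => c * f k) = c * psum n f.
Proof. by rewrite /psum mulrDr mulr_sumr mulrA. Qed.

(** The middle term is its own mirror image, hence the weight 1/2 which it has
    in the primed sum. *)
Lemma sum_fold_even n (f : nat -> F) :
  (forall k, (k <= 2 * n)%N -> f (2 * n - k)%N = f k) ->
  \sum_(k < (2 * n).+1) f k = 2%:R * psum n f.
Proof.
move=> fs; rewrite -(big_mkord xpredT f) (@big_cat_nat _ _ _ n)//=; last by lia.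
rewrite [X in _ + X]big_ltn; last by lia.
rewrite big_add1 /= [X in _ + (_ + X)]big_nat_rev/=.
have -> : \sum_(n <= i < 2 * n) f (n + 2 * n - i.+1).+1%N = \sum_(0 <= i < n) f i.
  rewrite -{1}[n]add0n big_addn (_ : (2 * n - n = n)%N); last by lia.
  apply: eq_big_nat => i /andP[_ hi]; rewrite -fs; last by lia.
  by congr f; lia.
by rewrite /psum -(big_mkord xpredT f); field.
Qed.

Lemma sum_fold_odd n (f : nat -> F) :
  (forall k, (k <= 2 * n + 1)%N -> f (2 * n + 1 - k)%N = f k) ->
  \sum_(k < (2 * n + 1).+1) f k = 2%:R * \sum_(k < n.+1) f k.
Proof.
move=> fs; rewrite -!(big_mkord xpredT f) (@big_cat_nat _ _ _ n.+1)//=; last by lia.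
rewrite mulr_natl mulr2n; congr (_ + _).
rewrite big_nat_rev/= -{1}[n.+1]add0n big_addn.
rewrite (_ : ((2 * n + 1).+1 - n.+1 = n.+1)%N); last by lia.
apply: eq_big_nat => i /andP[_ hi]; rewrite -fs; last by lia.
by congr f; lia.
Qed.

End bessel_poly.

(** * Reduction to products of Macdonald functions *)

Section reduction.
Variable R : realType.
Local Notation mu := (@lebesgue_measure R).

(** The Macdonald function and the polynomial obey the same three-term
    recurrence.  It starts from the orders 1/2 and 3/2, the latter being
    reached from 1/2 and -1/2. *)
Lemma macdonald_halfinteger N (z : R[i]) : 0 < complex.Re (z / 2%:R) ->
  macdonald (N%:R + 2^-1) (z / 2%:R) =
  (besselPoly (R[i] : numFieldType) N).[z^-1] * macdonald 2^-1 (z / 2%:R).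
Proof.
set w := z / 2%:R => w0.
have wn0 : w != 0 by apply: contraTneq w0 => ->; rewrite ltxx.
have zn0 : z != 0 by move: wn0; rewrite /w mulf_eq0 => /norP[].
have two_w (c : R) : c%:C / w = 2%:R * c%:C * z^-1.
  by rewrite /w; field; rewrite zn0.
suff : macdonald (N%:R + 2^-1) w = (besselPoly (R[i] : numFieldType) N).[z^-1] * macdonald 2^-1 w /\
    macdonald (N.+1%:R + 2^-1) w =
    (besselPoly (R[i] : numFieldType) N.+1).[z^-1] * macdonald 2^-1 w.
  by case.
elim: N => [|N [IH1 IH2]].
  rewrite besselPoly0 besselPoly1 hornerC mul1r add0r; split; first by [].
  rewrite addrC (macdonald_recurrence _ w0) (_ : 2^-1 - 1 = - 2^-1); last by field.
  rewrite macdonaldN divff ?pnatr_eq0// two_w rmorph1 mulr1.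
  by rewrite hornerD hornerZ hornerX hornerC [in RHS]mulrDl mul1r.
split; first exact: IH2.
have -> : N.+2%:R + 2^-1 = (N.+1%:R + 2^-1) + 1 :> R by rewrite -natr1; ring.
rewrite (macdonald_recurrence _ w0) (_ : N.+1%:R + 2^-1 - 1 = N%:R + 2^-1); last first.
  by rewrite -natr1; ring.
rewrite IH1 IH2 two_w besselPoly_rec hornerD hornerZ hornerM hornerX.
have -> : 2 * (N.+1%:R + 2^-1) = (2 * N + 3)%:R :> R.
  by rewrite natrD natrM -natr1; field.
move: (macdonald 2^-1 w) (_.[z^-1]) (_.[z^-1]) => k p q.
by rewrite rmorph_nat natrM; ring.
Qed.

Lemma expand_rcosh (M : nat) (t : R) : rcosh t ^+ M =
  \sum_(k < M.+1) ('C(M, k)%:R / 2 ^+ M) * expR ((M%:R - 2 * k%:R) * t).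
Proof.
rewrite /rcosh exprMn exprDn exprVn mulr_suml; apply: eq_bigr => k _.
have kM : (k <= M)%N by rewrite -ltnS.
rewrite -!expRM_natl -expRD -mulr_natl; rewrite mulrAC; congr (_ * expR _).
by rewrite natrB//; ring.
Qed.

(** The binomial expansion of cosh^M t makes the function of t under the
    integral a combination of inner integrals of planar integrands.  It is
    even in t, and so its integral over the half-line is half of the one over
    the line. *)
Lemma calF_sum (M N : nat) (z : R[i]) : 0 < complex.Re z ->
  calF M%:R N%:R z = (2%:R ^+ M.+1)^-1 * \sum_(k < M.+1) 'C(M, k)%:R *
    (macdonald ((M%:R - 2 * k%:R + N%:R) / 2) (z / 2%:R) *
     macdonald ((M%:R - 2 * k%:R - N%:R) / 2) (z / 2%:R)).
Proof.
move=> z0.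
have zc0 t : 0 < complex.Re (z * (rcosh t)%:C).
  by rewrite Re_mul/= mulr0 subr0 mulr_gt0// rcosh_gt0.
pose c k : R[i] := 'C(M, k)%:R / 2%:R ^+ M / 2%:R.
pose I k t := cint mu (planar (M%:R - 2 * k%:R) N%:R z t).
pose f t := (rcosh t `^ M%:R)%:C * besselK N%:R (z * (rcosh t)%:C).
have fE t : f t = \sum_(k < M.+1) c k * I k t.
  rewrite /f powR_mulrn; last exact/ltW/rcosh_gt0.
  have -> : (N%:R : R[i]) = (N%:R : R)%:C by rewrite rmorph_nat.
  rewrite besselK_macdonald expand_rcosh rmorph_sum/= mulr_suml; apply: eq_bigr => k _.
  rewrite /I /planar cintZ; last exact: cintegrable_expcosh.
  rewrite (cint_expcosh N%:R (zc0 t)) /c rmorphM/= rmorphM/= fmorphV rmorphXn/= !rmorph_nat.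
  by field; rewrite ?expf_eq0 ?pnatr_eq0 ?andbF.
have icI k : cintegrable mu (fun t => c k * I k t).
  by apply: cintegrableZ; exact: cintegrable_planar.
have icf : cintegrable mu f.
  rewrite (_ : f = fun t => \sum_(k < M.+1) c k * I k t); last exact/funext.
  exact: (cintegrable_sum M.+1 icI).
have ef t : f (- t) = f t by rewrite /f rcoshN.
have : cint mu f = 2%:R * calF M%:R N%:R z by exact: cint_even.
rewrite (@eq_cint _ (measurableTypeR R) R mu _ _ fE).
rewrite (@cint_sum _ (measurableTypeR R) R mu M.+1 _ icI) => E.
have n2 : 2%:R != 0 :> R[i] by rewrite pnatr_eq0.
apply: (mulfI n2); rewrite -E mulrA mulr_sumr; apply: eq_bigr => k _.
rewrite cintZ; last exact: cintegrable_planar.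
rewrite (cint_planar _ _ z0) /c exprSr; field.
by rewrite ?expf_eq0 ?pnatr_eq0 ?andbF.
Qed.

Lemma macdonald_half_square_halved (z : R[i]) : 0 < complex.Re z ->
  macdonald 2^-1 (z / 2%:R) ^+ 2 = pi%:C * cexp (- z) / z.
Proof.
move=> z0; have -> : z / 2%:R = z * (2^-1)%:C by rewrite fmorphV rmorph_nat.
rewrite macdonald_half_square; last by rewrite Re_mul/= mulr0 subr0 mulr_gt0.
have -> // : 2%:R * (z * (2^-1)%:C) = z.
by rewrite fmorphV rmorph_nat mulrCA divff ?mulr1// pnatr_eq0.
Qed.

End reduction.

(** * The closed forms *)

Section polynomials.
Variable F : numFieldType.
Implicit Types (m n k : nat) (z : F).
Local Notation Q N z := (besselPoly F N).[z^-1].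

Lemma convCoef_sum A B P (c z : F) : (A + B < P)%N ->
  \sum_(p < P) (c * convCoef (betaCoef F A) (betaCoef F B) p) * z ^- p =
  c * (Q A z * Q B z).
Proof.
move=> ABP; rewrite -(convCoef_horner z^-1 ABP) mulr_sumr.
by apply: eq_bigr => p _; rewrite mulrA exprVn.
Qed.

(** The second order is, up to sign, m - n + k + 1/2.  As the Macdonald
    function is even in its order, this is N + 1/2 for a natural number N in
    both cases. *)
Definition evenIndex m n k := if (n <= m + k)%N then (m + k - n)%N else (n - m - k - 1)%N.

(** Likewise for the second order n - m - k + 1/2 of the odd case. *)
Definition oddIndex m n k := if (m + k <= n)%N then (n - m - k)%N else (m + k - n - 1)%N.

Lemma sumP_horner m n z : sumP m n z =
  psum n (fun k => 'C(2 * n, k)%:R * (Q (m + n - k) z * Q (evenIndex m n k) z)).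
Proof.
rewrite /sumP; case: ifPn => mn.
  apply: etrans (psum_exchange n _ (fun p k => 'C(2 * n, k)%:R *
    convCoef (betaCoef F (m + n - k)) (betaCoef F (m + k - n)) p) (fun p => z ^- p)) _.
  apply: eq_psum => k kn.
  rewrite /evenIndex (_ : (n <= m + k)%N); last by lia.
  by rewrite convCoef_sum//; lia.
apply: etrans (psum_exchange n _ (fun p k => 'C(2 * n, k)%:R *
  convCoef (betaCoef F (m + n - k)) (bhat F m n k) p) (fun p => z ^- p)) _.
apply: eq_psum => k kn; rewrite /bhat /evenIndex.
case: ifPn => h1; case: ifPn => h2; try lia.
  by rewrite convCoef_sum//; lia.
by rewrite convCoef_sum//; lia.
Qed.

Lemma sumPhat_horner m n z : sumPhat m n z =
  \sum_(k < n.+1) 'C((2 * n).+1, k)%:R * (Q (m + n - k) z * Q (oddIndex m n k) z).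
Proof.
rewrite /sumPhat; case: ifPn => mn.
  under eq_bigr do rewrite mulr_suml.
  rewrite exchange_big/=; apply: eq_bigr => k _; have kn := ltn_ord k.
  rewrite /oddIndex ifN; last by lia.
  by rewrite convCoef_sum//; lia.
under eq_bigr do rewrite mulr_suml.
rewrite exchange_big/=; apply: eq_bigr => k _; have kn := ltn_ord k.
rewrite /btilde /oddIndex.
case: ifPn => h1; case: ifPn => h2; try lia.
  by rewrite convCoef_sum//; lia.
by rewrite convCoef_sum//; lia.
Qed.

End polynomials.

Section fold.
Variable R : realType.
Implicit Types (m n k M N : nat) (z : R[i]).
Local Notation Q N z := (besselPoly (R[i] : numFieldType) N).[z^-1].

Definition calF_term M N z k : R[i] := 'C(M, k)%:R *
    (macdonald ((M%:R - 2 * k%:R + N%:R) / 2) (z / 2%:R) *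
     macdonald ((M%:R - 2 * k%:R - N%:R) / 2) (z / 2%:R)).

(** Replacing k with M - k exchanges the two orders and changes their signs. *)
Lemma calF_term_sym M N z k : (k <= M)%N ->
  calF_term M N z (M - k) = calF_term M N z k.
Proof.
move=> kM; rewrite /calF_term (bin_sub kM) (natrB _ kM); congr (_ * _).
rewrite -[macdonald ((M%:R - 2 * k%:R - N%:R) / 2) _]macdonaldN.
rewrite -[macdonald ((M%:R - 2 * k%:R + N%:R) / 2) _]macdonaldN.
rewrite [RHS]mulrC; congr (macdonald _ _ * macdonald _ _); ring.
Qed.

Variable z : R[i].
Hypothesis z0 : 0 < complex.Re z.

Let w0 : 0 < complex.Re (z / 2%:R).
Proof.
have -> : z / 2%:R = z * (2^-1)%:C by rewrite fmorphV rmorph_nat.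
by rewrite Re_mul/= mulr0 subr0 mulr_gt0.
Qed.

Lemma macdonald_product A B (a b : R) :
  a = A%:R + 2^-1 -> b = B%:R + 2^-1 \/ b = - (B%:R + 2^-1) ->
  macdonald a (z / 2%:R) * macdonald b (z / 2%:R) = pi%:C * cexp (- z) / z * (Q A z * Q B z).
Proof.
move=> -> hb.
have -> : macdonald b (z / 2%:R) = macdonald (B%:R + 2^-1) (z / 2%:R).
  by case: hb => ->; rewrite ?macdonaldN.
rewrite !(macdonald_halfinteger _ w0) -(macdonald_half_square_halved z0).
by move: (macdonald 2^-1 _) (Q A z) (Q B z) => x y y'; ring.
Qed.

Lemma calF_term_even m n k : (k <= n)%N ->
  calF_term (2 * n) (2 * m + 1) z k = pi%:C * cexp (- z) / z *
    ('C(2 * n, k)%:R * (Q (m + n - k) z * Q (evenIndex m n k) z)).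
Proof.
move=> kn; rewrite /calF_term [RHS]mulrCA; congr (_ * _); apply: macdonald_product.
  rewrite natrB; last by lia.
  by rewrite !(natrD, natrM); field.
rewrite /evenIndex; case: ifPn => h.
  by right; rewrite natrB// !(natrD, natrM); field.
left; rewrite -!subnDA natrB; last by lia.
by rewrite !(natrD, natrM); field.
Qed.

Lemma calF_term_odd m n k : (k <= n)%N ->
  calF_term (2 * n + 1) (2 * m) z k = pi%:C * cexp (- z) / z *
    ('C((2 * n).+1, k)%:R * (Q (m + n - k) z * Q (oddIndex m n k) z)).
Proof.
move=> kn; rewrite /calF_term [RHS]mulrCA addn1; congr (_ * _).
apply: macdonald_product.
  rewrite natrB; last by lia.
  by rewrite -addn1 !(natrD, natrM); field.
rewrite /oddIndex; case: ifPn => h.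
  left; rewrite -!subnDA natrB; last by lia.
  by rewrite -addn1 !(natrD, natrM); field.
right; rewrite -!subnDA natrB; last by lia.
by rewrite -addn1 !(natrD, natrM); field.
Qed.

End fold.

Theorem theorem1 (R : realType) (m n : nat) (z : R[i])
    (hz : 0 < complex.Re z) :
  calF (2 * n)%:R (2 * m + 1)%:R z
    = pi%:C * cexp (- z) / (2%:R ^+ (2 * n) * z) * sumP m n z
  /\ calF (2 * n + 1)%:R (2 * m)%:R z
    = pi%:C * cexp (- z) / (2%:R ^+ (2 * n + 1) * z) * sumPhat m n z.
Proof.
have zn0 : z != 0 by apply: contraTneq hz => ->; rewrite ltxx.
have n2 : 2%:R != 0 :> R[i] by rewrite pnatr_eq0.
split.
  rewrite (calF_sum _ _ hz) (@sum_fold_even _ _ (calF_term _ _ z)); last first.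
    by move=> k; exact: calF_term_sym.
  rewrite (eq_psum (calF_term_even hz m (n := n))) psumZ -sumP_horner exprS.
  by field; rewrite ?zn0 ?expf_neq0.
rewrite (calF_sum _ _ hz) (@sum_fold_odd _ _ (calF_term _ _ z)); last first.
  by move=> k; exact: calF_term_sym.
have E k : (k < n.+1)%N -> _ := fun kn => @calF_term_odd R z hz m n k kn.
under eq_bigr => k _ do rewrite E//.
rewrite -mulr_sumr -sumPhat_horner exprS.
by field; rewrite ?zn0 ?expf_neq0.
Qed.
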